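(* Let $\mathcal D\subset\mathbb D$ be the pole region, let $\bar R>0$, and let $\mathscr G$ be the class of target systems defined in the context. For any selected poles $\{\mu_k\}$ (for each $q$, points $\mu_1,\dots,\mu_q\in\mathbb D$, possibly depending on $q$), $$\liminf_{q\to\infty}\ \max_{G\in\mathscr G}\ \min_{\check R_1,\dots,\check R_q\in\mathbb C^{p\times m}}\left\|G-\sum_{k=1}^q\frac{\check R_k}{z-\mu_k}\right\|_2^{1/q}\ge\tau(\mathcal D),$$ where $\tau(\mathcal D)$ is the hyperbolic Chebyshev constant of $\mathcal D$. On the other hand, when $\{\mu_k\}$ are chosen as the $q$-th Tsuji points $\eta_{q1},\dots,\eta_{qq}$ of $\mathcal D$, the following equality holds: $$\lim_{q\to\infty}\ \max_{G\in\mathscr G}\ \min_{\check R_1,\dots,\check R_q\in\mathbb C^{p\times m}}\left\|G-\sum_{k=1}^q\frac{\check R_k}{z-\eta_{qk}}\right\|_2^{1/q}=\tau(\mathcal D).$$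
   Context: $\mathbb D=\{z\in\mathbb C:|z|<1\}$. The pole region $\mathcal D\subset\mathbb D$ is a closed continuum (compact connected set). **Class of systems.** $\mathscr G$ is the set of $p\times m$ transfer function matrices of the form $G(z)=\sum_{j=1}^n\frac{R_j}{z-\lambda_j}$, where $n$ is the number of poles of $G$ (finite, arbitrary), the poles $\lambda_j\in\mathcal D$ are distinct, $R_j\in\mathbb C^{p\times m}$, and $\sum_{j=1}^n\|R_j\|\le\bar R$, with $\|\cdot\|$ the Frobenius norm. **Norm.** For a strictly stable $F(z)$, $\|F\|_2^2=\frac1{2\pi}\int_{-\pi}^{\pi}\mathrm{tr}(F(e^{i\omega})F(e^{i\omega})^H)\,d\omega$ ($\mathcal H_2$ norm). **Hyperbolic notions.** $[z,\mu]_{\mathrm h}=\left|\frac{z-\mu}{1-\bar\mu z}\right|$ for $z,\mu\in\mathbb D$. The hyperbolic Chebyshev constant is $$\tau(\mathcal D)=\lim_{q\to\infty}\min_{\mu_1,\dots,\mu_q\in\mathcal D}\max_{z\in\mathcal D}\Big(\prod_{k=1}^q[z,\mu_k]_{\mathrm h}\Big)^{1/q}$$ (the limit always exists). The $q$-th Tsuji points of $\mathcal D$ are points $z_1,\dots,z_q\in\mathcal D$ attaining $\max_{z_1,\dots,z_q\in\mathcal D}\prod_{1\le j<k\le q}[z_j,z_k]_{\mathrm h}$ (the maximization may be restricted to $\partial\mathcal D$). *)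

(* Defs.v *)
From HB Require Import structures.
From mathcomp Require Import all_boot all_order all_algebra.
From mathcomp Require Import complex.
From mathcomp Require Import all_classical all_reals all_analysis.

Set Implicit Arguments.
Unset Strict Implicit.
Unset Printing Implicit Defensive.

Import Order.TTheory GRing.Theory Num.Theory.
Import ComplexField.
Import numFieldNormedType.Exports.

Local Open Scope classical_set_scope.
Local Open Scope ring_scope.
Local Open Scope sesquilinear_scope.

(* Real-valued modulus: `|z| on R[i] lives in R[i]. *)
Definition cabs (R : realType) (z : R[i]) : R := Normc.normc z.

Definition disc (R : realType) : set R[i] := [set z | cabs z < 1].

Definition hdist (R : realType) (z mu : R[i]) : R :=
  cabs ((z - mu) / (1 - mu^* * z)).

(* For D nonempty and compact in the disc, the sup and the inf are a max and a
   min by continuity and compactness, and the limit exists (the sequence of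
   q-th powers is submultiplicative). The term q = 0 equals 1. *)
Definition hyp_chebyshev (R : realType) (D : set R[i]) : R :=
  lim ((fun q : nat =>
    inf [set sup [set (\prod_(k < q) hdist z (mu k)) `^ (q%:R^-1) | z in D]
        | mu in [set mu : 'I_q -> R[i] | forall k, D (mu k)]] : R) @ \oo).

Definition is_tsuji (R : realType) (D : set R[i]) (q : nat)
    (eta : 'I_q -> R[i]) : Prop :=
  (forall k, D (eta k)) /\
  forall z : 'I_q -> R[i], (forall k, D (z k)) ->
    \prod_(k < q) \prod_(j < q | (j < k)%N) hdist (z j) (z k) <=
    \prod_(k < q) \prod_(j < q | (j < k)%N) hdist (eta j) (eta k).

Definition frob (R : realType) (p m : nat) (A : 'M[R[i]]_(p, m)) : R :=
  Num.sqrt (\sum_i \sum_j cabs (A i j) ^+ 2).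

(* z |-> \sum_j Res_j / (z - lam_j), as a total function; the junk value 0 of
   a term at its pole is never seen by h2norm when the poles lie in the disc. *)
Definition pole_sum (R : realType) (p m n : nat) (lam : 'I_n -> R[i])
    (Res : 'I_n -> 'M[R[i]]_(p, m)) : R[i] -> 'M[R[i]]_(p, m) :=
  fun z => \sum_(j < n) (z - lam j)^-1 *: Res j.

(* Residues may vanish: dropping the zero terms leaves both the function and
   the bound unchanged, so this is the class of functions whose genuine poles
   lie in D. *)
Definition systems (R : realType) (D : set R[i]) (Rbar : R) (p m : nat) :
    set (R[i] -> 'M[R[i]]_(p, m)) :=
  [set G | exists n (lam : 'I_n -> R[i]) (Res : 'I_n -> 'M[R[i]]_(p, m)),
    [/\ injective lam, forall j, D (lam j),
        \sum_(j < n) frob (Res j) <= Rbar & G = pole_sum lam Res]].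

(* The trace is real and nonnegative; complex.Re only changes its type. *)
Definition h2norm (R : realType) (p m : nat)
    (F : R[i] -> 'M[R[i]]_(p, m)) : R :=
  Num.sqrt ((pi *+ 2)^-1 *
    \int[@lebesgue_measure R]_(w in `[- pi, pi])
      (let z := (cos w +i* sin w)%C in complex.Re (\tr (F z *m (F z)^t*)))).

Definition is_min (R : realType) (A : set R) (x : R) := A x /\ lbound A x.

Definition is_max (R : realType) (A : set R) (x : R) := A x /\ ubound A x.

Definition fit_errors (R : realType) (p m q : nat) (mu : 'I_q -> R[i])
    (G : R[i] -> 'M[R[i]]_(p, m)) : set R :=
  [set h2norm (fun z => G z - pole_sum mu Res z) `^ (q%:R^-1)
  | Res in [set: 'I_q -> 'M[R[i]]_(p, m)]].

(* e is the value of  max_(G in systems) min (fit_errors mu G),  all the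
   extrema being attained. *)
Definition is_maxmin_error (R : realType) (D : set R[i]) (Rbar : R)
    (p m q : nat) (mu : 'I_q -> R[i]) (e : R) : Prop :=
  exists2 best : (R[i] -> 'M[R[i]]_(p, m)) -> R,
    forall G, systems D Rbar G -> is_min (fit_errors mu G) (best G) &
    is_max [set best G | G in systems D Rbar (p := p) (m := m)] e.

(* Main.v *)
Require Import Defs.
From HB Require Import structures.
From mathcomp Require Import all_boot all_order all_algebra.
From mathcomp Require Import complex.
From mathcomp Require Import all_classical all_reals all_analysis.
From mathcomp Require Import ring lra.

Set Implicit Arguments.
Unset Strict Implicit.
Unset Printing Implicit Defensive.

Import Order.TTheory GRing.Theory Num.Theory.
Import numFieldNormedType.Exports.

Local Open Scope classical_set_scope.
Local Open Scope ring_scope.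
Local Open Scope sesquilinear_scope.

(* For distinct mu_k the distance in H2 from 1 / (z - lam) to the span of the
   1 / (z - mu_k) is |B(lam)| / sqrt (1 - |lam|^2), with B the Blaschke product
   of the mu_k; by the triangle inequality the worst system has a single pole,
   so everything reduces to the maximum of |B| over D.

   Let V_n be the maximal Tsuji product of n points of D.  Deleting points shows
   that V_n^(2 / (n (n - 1))) decreases to a limit d, and comparing consecutive
   V_n shows that the Blaschke product of the q-th Tsuji points is at most
   d_q^q on D with d_q -> d.  Conversely |B| >= d^q somewhere on D for every B of
   degree q with zeros anywhere in the disc: V_n^2 is at most the Gram
   determinant of n Szego kernels, and approximating these kernels by the
   Malmquist system of B, B^2, B^3, ... bounds that determinant by about
   (max_D |B|)^(n^2 / q) as n grows.  Hence d is the hyperbolic Chebyshev constant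
   and both parts of the theorem follow. *)

(** * Determinants and approximation numbers *)

Lemma dotmx_row (C : numClosedFieldType) n (u v : 'rV[C]_n) :
  dotmx u v = \sum_i u 0 i * (v 0 i)^*.
Proof. by rewrite dotmxE mxE; apply: eq_bigr => i _; rewrite !mxE. Qed.

Lemma dotmx_row_mx (C : numClosedFieldType) m n (u : 'rV[C]_m) (v : 'rV[C]_n) :
  dotmx (row_mx u v) (row_mx u v) = dotmx u u + dotmx v v.
Proof. by rewrite !dotmxE tr_row_mx map_col_mx mul_row_col mxE. Qed.

Lemma dotmx_mul_unitary (C : numClosedFieldType) n (u v : 'rV[C]_n)
    (U : 'M[C]_n) :
  U \is unitarymx -> dotmx (u *m U) (v *m U) = dotmx u v.
Proof.
move=> Uu; rewrite !dotmxE trmx_mul map_mxM !mulmxA.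
by rewrite -[u *m U *m _]mulmxA (unitarymxP Uu) mulmx1.
Qed.

Lemma norm_det_unitarymx (C : numClosedFieldType) n (U : 'M[C]_n) :
  U \is unitarymx -> `|\det U| = 1.
Proof.
move=> /unitarymxP/(congr1 determinant); rewrite det_mulmx det1 det_map_mx.
rewrite det_tr -normCK => /eqP.
by rewrite -[X in _ == X](expr1n _ 2) eqrXn2// => /eqP.
Qed.

(** Gram-Schmidt applied to the matrix all of whose rows are [v]; this also covers [v = 0]. *)
Lemma unitary_row0 (C : numClosedFieldType) n (v : 'rV[C]_n.+1) :
  exists2 U : 'M[C]_n.+1, U \is unitarymx & exists c, v = c *: row 0 U.
Proof.
pose A : 'M[C]_n.+1 := \matrix_i v.
exists (schmidt A); first exact: schmidt_unitarymx.
have := row_schmidt_sub A 0; rewrite rowK.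
rewrite (big_pred1 0) => [|i]; last by rewrite /= leqn0.
by rewrite genmxE => /sub_rVP.
Qed.

(* The rows of a unitary matrix whose [k]-th row annihilates [Psi k] reduce the
   claim to Hadamard's inequality; both are obtained in a single induction that
   splits off one row at a time. *)
Lemma det_width_bound (C : numClosedFieldType) n (A : 'M[C]_n) (t : nat -> C) :
  (forall k, (k < n)%N -> exists Psi : 'M[C]_(n, k), forall v : 'rV[C]_n,
     v *m Psi = 0 -> dotmx (v *m A) (v *m A) <= t k * dotmx v v) ->
  `|\det A| ^+ 2 <= \prod_(k < n) t k.
Proof.
elim: n A => [|n IHn] A tA; first by rewrite det_mx00 big_ord0 normr1 expr1n.
have [Psi PsiP] := tA n (ltnSn n).
(* [Psi] has one column fewer than rows, so its left kernel is nonzero. *)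
have [v v0 vPsi] : exists2 v : 'rV[C]_n.+1, v != 0 & v *m Psi = 0.
  exists (nz_row (kermx Psi)); last by apply/sub_kermxP; exact: nz_row_sub.
  rewrite nz_row_eq0 -mxrank_eq0 mxrank_ker subn_eq0 -ltnNge ltnS.
  exact: rank_leq_col.
have [U Uu [c vU]] := unitary_row0 v.
have c0 : c != 0 by apply: contraNneq v0 => c0; rewrite vU c0 scale0r.
have uPsi : row 0 U *m Psi = 0.
  by apply: (scalerI c0); rewrite scaler0 scalemxAl -vU.
(* The image under [A] of the first row of [U] is [s] times the first row of [W]. Hence [U A W^H]
   has first row [(s, 0, ..., 0)], and [s] splits off from its determinant. *)
have [W Wu [s uAW]] := unitary_row0 (row 0 U *m A).
have u1 : dotmx (row 0 U) (row 0 U) = 1 by rewrite (row_unitarymxP Uu) eqxx.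
have s_le : `|s| ^+ 2 <= t n.
  have := PsiP _ uPsi; rewrite u1 mulr1 uAW dotmxE -scalemxAl linearZ/=.
  rewrite map_mxZ -scalemxAr scalerA -normCK !mxE.
  by have := row_unitarymxP Wu 0 0; rewrite dotmxE !mxE eqxx => -> /[!mulr1].
have Wtu : W^t* \is unitarymx by rewrite trmxC_unitary.
have [M defM] : exists M : 'M[C]_(1 + n), M = U *m A *m (W^t*) by exists (U *m
  A *m W^t* ).
have detM : `|\det M| = `|\det A|.
  rewrite defM !det_mulmx !normrM (norm_det_unitarymx Uu).
  by rewrite (norm_det_unitarymx Wtu) mul1r mulr1.
have M0 : row 0 M = s *: row 0 1%:M.
  rewrite defM !row_mul uAW -scalemxAl -row_mul.
  by rewrite (unitarymxP Wu).
have ord0l m' (i : 'I_1) : lshift m' i = 0 by apply/val_inj; rewrite /= ord1.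
have ulM : ulsubmx M = s%:M.
  apply/matrixP => i j; have /rowP/(_ 0) := M0.
  by rewrite !mxE !ord0l !ord1 eqxx mulr1 => ->.
have urM : ursubmx M = 0.
  apply/matrixP => i j; have /rowP/(_ (rshift 1 j)) := M0.
  by rewrite !mxE !ord0l /= mulr0 => ->.
rewrite -detM -[M]submxK urM det_lblock ulM det_scalar1 normrM exprMn.
rewrite big_ord_recr/= mulrC ler_pM ?exprn_ge0//.
apply: IHn => k kn; have [Phi PhiP] := tA k (ltnW kn).
(* The lower right block is tested on vectors [(0, w)], which [U] maps isometrically onto the
   orthogonal complement of its first row. *)
exists ((dsubmx (U : 'M[C]_(1 + n, _))) *m Phi) => w wPhi.
pose w' : 'rV[C]_(1 + n) := row_mx 0 w.
have w'U : w' *m U = w *m dsubmx (U : 'M[C]_(1 + n, _)).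
  by rewrite -{1}[U](@vsubmxK _ 1 n) mul_row_col mul0mx add0r.
have dw : dotmx (w' *m U) (w' *m U) = dotmx w w.
  have := dotmx_row_mx (0 : 'rV[C]_1) w.
  rewrite [X in _ = X + _]dotmxE mul0mx [X in _ = X + _]mxE add0r => <-.
  exact: (dotmx_mul_unitary w' w' Uu).
have := PhiP (w' *m U); rewrite w'U -mulmxA => /(_ wPhi); rewrite -w'U dw.
apply: le_trans; rewrite -(dotmx_mul_unitary _ _ Wtu).
rewrite -[w' *m U *m A]mulmxA -[w' *m _ *m _]mulmxA -defM.
have -> : w' *m M = row_mx (w *m dlsubmx M) (w *m drsubmx M).
  by rewrite -[M in LHS]submxK mul_row_block !mul0mx !add0r.
have splitM := dotmx_row_mx (w *m dlsubmx M) (w *m drsubmx M).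
apply: (@le_trans _ _ (dotmx (w *m dlsubmx M) (w *m dlsubmx M) +
                       dotmx (w *m drsubmx M) (w *m drsubmx M))).
  rewrite lerDr dotmx_row; apply: sumr_ge0 => i _; exact: mul_conjC_ge0.
by rewrite -splitM; exact: lexx.
Qed.

(** * Szego kernels and the Malmquist system *)

(** The quadratic form of the Gram matrix [A A^H], the shape in which [szego_malmquist] can be
    applied to the inner sum. *)
Lemma dotmx_mulmx (C : numClosedFieldType) m n (v : 'rV[C]_m) (A : 'M[C]_(m, n)) :
  dotmx (v *m A) (v *m A) =
  \sum_i \sum_j v 0 i * (v 0 j)^* * \sum_k A i k * (A j k)^*.
Proof.
rewrite dotmx_row; under eq_bigr => k _.
  rewrite !mxE rmorph_sum/= big_distrl/=.
  under eq_bigr do rewrite big_distrr/=.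
  over.
rewrite exchange_big/=; apply: eq_bigr => i _.
rewrite exchange_big/=; apply: eq_bigr => j _.
rewrite big_distrr/=; apply: eq_bigr => k _.
by rewrite rmorphM/= mulrACA.
Qed.

Section Kernel.
Context {C : numClosedFieldType}.
Implicit Types (z w a : C) (mu : nat -> C).

Definition szego z w : C := (1 - z * w^*)^-1.

Definition blaschke a z : C := (z - a) / (1 - a^* * z).

Definition blaschke_prod mu n z : C := \prod_(k < n) blaschke (mu k) z.

(* The Takenaka-Malmquist orthonormal system attached to [mu]. *)
Definition malmquist mu k z : C :=
  sqrtC (1 - `|mu k| ^+ 2) / (1 - (mu k)^* * z) * blaschke_prod mu k z.

Lemma disc_den_neq0 a z : `|a| < 1 -> `|z| < 1 -> 1 - a^* * z != 0.
Proof.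
move=> a1 z1; rewrite subr_eq0; apply/eqP => e.
have := congr1 Num.norm e; rewrite normr1 normrM norm_conjC => e1.
by have := mulr_ilt1 (normr_ge0 _) (normr_ge0 _) a1 z1; rewrite -e1 ltxx.
Qed.

Lemma disc_den_neq0' a z : `|a| < 1 -> `|z| < 1 -> 1 - a * z^* != 0.
Proof. by move=> a1 z1; rewrite mulrC disc_den_neq0. Qed.

Lemma blaschkexx a : blaschke a a = 0.
Proof. by rewrite /blaschke subrr mul0r. Qed.

Lemma szego_blaschke a z w : `|a| < 1 -> `|z| < 1 -> `|w| < 1 ->
  szego z w * (1 - blaschke a z * (blaschke a w)^*) =
  (1 - `|a| ^+ 2) / (1 - a^* * z) / (1 - a * w^*).
Proof.
move=> a1 z1 w1; rewrite /szego /blaschke rmorphM fmorphV !rmorphB.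
rewrite /= conjC1 rmorphM/= conjCK normCK.
have := disc_den_neq0' z1 w1; have := disc_den_neq0 a1 z1.
have := disc_den_neq0' a1 w1.
move: (z^*) (w^*) (a^*) => z' w' a' h1 h2 h3; field.
by rewrite h1 h2 h3.
Qed.

(** Telescoping: by [szego_blaschke], one more Blaschke factor changes the left-hand side by exactly
    one term of the sum. Where one of the products vanishes, the finite sum is the whole kernel. *)
Lemma szego_malmquist mu n z w :
  (forall k, `|mu k| < 1) -> `|z| < 1 -> `|w| < 1 ->
  szego z w * (1 - blaschke_prod mu n z * (blaschke_prod mu n w)^*) =
  \sum_(k < n) malmquist mu k z * (malmquist mu k w)^*.
Proof.
move=> mu1 z1 w1; elim: n => [|n IHn].
  by rewrite /blaschke_prod !big_ord0 conjC1 mulr1 subrr mulr0.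
rewrite big_ord_recr/= -IHn /malmquist.
have -> : blaschke_prod mu n.+1 z = blaschke_prod mu n z * blaschke (mu n) z.
  by rewrite /blaschke_prod big_ord_recr.
have -> : blaschke_prod mu n.+1 w = blaschke_prod mu n w * blaschke (mu n) w.
  by rewrite /blaschke_prod big_ord_recr.
set s := sqrtC _.
have s2 : s * s^* = 1 - `|mu n| ^+ 2.
  rewrite -normCK -normrX sqrtCK ger0_norm// subr_ge0.
  by rewrite expr_le1 ?normr_ge0// ltW.
have := szego_blaschke (mu1 n) z1 w1; rewrite -s2.
set p := blaschke_prod _ _ z; set q := blaschke_prod _ _ w.
set b := blaschke _ z; set c := blaschke _ w; set K := szego _ _.
have -> : (s / (1 - (mu n)^* * w) * q)^* = s^* / (1 - mu n * w^*) * q^*.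
  by rewrite !rmorphM/= fmorphV rmorphB/= conjC1 rmorphM/= conjCK.
rewrite !(rmorphM _ q) /=.
move=> e.
have -> : K * (1 - p * b * (q^* * c^*)) = K * (1 - p * q^*) + p * q^* * (K * (1
  - b * c^*)).
  ring.
by rewrite e; ring.
Qed.

Lemma malmquist_eq0 mu k i : (i < k)%N -> malmquist mu k (mu i) = 0.
Proof.
move=> ik; rewrite /malmquist /blaschke_prod (bigD1 (Ordinal ik))//=.
by rewrite blaschkexx mul0r mulr0.
Qed.

Lemma norm_szego_le (r : C) z w : 0 <= r < 1 -> `|z| <= r -> `|w| <= r ->
  `|szego z w| <= (1 - r ^+ 2)^-1.
Proof.
move=> /andP[r0 r1] zr wr; rewrite /szego normfV.
have d0 : 0 < 1 - r ^+ 2 by rewrite subr_gt0 exprn_ilt1.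
have h : 1 - r ^+ 2 <= `|1 - z * w^*|.
  apply: le_trans (lerB_dist _ _); rewrite normr1 lerB// normrM norm_conjC expr2.
  exact: ler_pM.
by rewrite lef_pV2// posrE// (lt_le_trans d0).
Qed.

Lemma sum_norm_mul_le n (x : 'I_n -> C) :
  \sum_i \sum_j `|x i| * `|x j| <= n%:R * \sum_i `|x i| ^+ 2.
Proof.
apply: (@le_trans _ _ (\sum_i \sum_j (`|x i| ^+ 2 + `|x j| ^+ 2) / 2)).
  apply: ler_sum => i _; apply: ler_sum => j _.
  rewrite ler_pdivlMr ?ltr0n// -subr_ge0.
  have -> : `|x i| ^+ 2 + `|x j| ^+ 2 - `|x i| * `|x j| * 2 =
            (`|x i| - `|x j|) ^+ 2 by ring.
  by rewrite real_exprn_even_ge0// realB// normr_real.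
under eq_bigr do rewrite -mulr_suml big_split/= sumr_const card_ord.
rewrite -mulr_suml big_split/= sumr_const card_ord -sumrMnl -mulr2n.
by rewrite -[_ *+ 2]mulr_natr mulfK ?pnatr_eq0// mulr_natl sumrMnl.
Qed.

(* Both sides are squared volumes of Szego kernels: the left-hand side (a Cauchy
   determinant) bounds their Gram determinant from below, the right-hand side
   from above by approximating them from the first [k] Malmquist functions of an
   arbitrary sequence [mu], for each [k < n]. *)
Lemma tsuji_prod_le_width (r : C) (z mu : nat -> C) (b : nat -> C) n :
  0 <= r < 1 -> (forall i, `|z i| <= r) -> (forall i, `|mu i| < 1) ->
  (forall k i, `|blaschke_prod mu k (z i)| <= b k) ->
  \prod_(i < n) `|blaschke_prod z i (z i)| ^+ 2 <=
  \prod_(k < n) (n%:R / (1 - r ^+ 2) * b k ^+ 2).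
Proof.
move=> r01 zr mu1 zb; have /andP[r0 r1] := r01.
have z1 i : `|z i| < 1 by apply: le_lt_trans r1.
(* The Malmquist system of the nodes, evaluated at these same nodes, is triangular, and [A A^H] is
   the matrix of their Szego kernels. *)
pose A : 'M[C]_n := \matrix_(i, k) malmquist z k (z i).
have Atrig : is_trig_mx A.
  by apply/is_trig_mxP => i j ij; rewrite mxE malmquist_eq0.
apply: (@le_trans _ _ (`|\det A| ^+ 2)).
  rewrite det_trig// normr_prod -prodrXl ler_prod// => i _.
  rewrite exprn_ge0//= mxE /malmquist normrM exprMn.
  rewrite ler_peMl ?exprn_ge0// -normCKC.
  have d0 : 0 < 1 - `|z i| ^+ 2 by rewrite subr_gt0 exprn_ilt1.
  rewrite -normrX exprMn sqrtCK exprVn expr2 invfM mulrA divff ?gt_eqF// mul1r.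
  by rewrite normfV gtr0_norm// invf_ge1// lerBlDr lerDl exprn_ge0.
apply: (det_width_bound (t := fun k => n%:R / (1 - r ^+ 2) * b k ^+ 2)) => k kn.
(* The constraint kills the first [k] Malmquist functions of [mu]. Subtracting their zero
   contribution multiplies the kernel by [blaschke_prod mu k] in one variable and by its conjugate
   in the other. *)
exists (\matrix_(i < n, j < k) malmquist mu j (z i)) => v vPsi.
rewrite -[leLHS]ger0_norm; last first.
  by rewrite dotmx_row sumr_ge0// => i _; rewrite mul_conjC_ge0.
have : dotmx (v *m \matrix_(i < n, j < k) malmquist mu j (z i))
    (v *m \matrix_(i < n, j < k) malmquist mu j (z i)) = 0.
  by rewrite vPsi dotmx_row big1// => i _; rewrite mxE mul0r.
rewrite dotmx_mulmx => /(congr1 (fun x => dotmx (v *m A) (v *m A) - x)).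
rewrite subr0 => <-; rewrite dotmx_mulmx -sumrB.
under eq_bigr => i _.
  rewrite -sumrB; under eq_bigr => j _.
    rewrite -mulrBr.
    under eq_bigr do rewrite !mxE.
    under [X in _ - X]eq_bigr do rewrite !mxE.
    rewrite -(szego_malmquist n z1)// -(szego_malmquist k mu1)//.
    have -> : blaschke_prod z n (z i) = 0.
      by rewrite /blaschke_prod (bigD1 i)//= blaschkexx mul0r.
    rewrite mul0r subr0 -mulrBr opprB addrCA subrr addr0.
    over.
  over.
have -> : dotmx v v = \sum_i `|v 0 i| ^+ 2.
  by rewrite dotmx_row; apply: eq_bigr => i _; rewrite normCK.
apply: (@le_trans _ _
  ((1 - r ^+ 2)^-1 * b k ^+ 2 * \sum_i \sum_j `|v 0 i| * `|v 0 j|)); last first.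
  have -> : n%:R / (1 - r ^+ 2) * b k ^+ 2 * \sum_i `|v 0 i| ^+ 2 =
      (1 - r ^+ 2)^-1 * b k ^+ 2 * (n%:R * \sum_i `|v 0 i| ^+ 2) by ring.
  apply: ler_wpM2l; last exact: sum_norm_mul_le.
  rewrite mulr_ge0//; first by rewrite invr_ge0 subr_ge0 exprn_ile1// ltW.
  by rewrite exprn_ge0// (le_trans (normr_ge0 _) (zb k 0%N)).
rewrite mulr_sumr; apply: le_trans (ler_norm_sum _ _ _) _.
apply: ler_sum => i _; rewrite mulr_sumr; apply: le_trans (ler_norm_sum _ _ _) _.
apply: ler_sum => j _; rewrite !normrM !norm_conjC mulrC ler_wpM2r ?mulr_ge0//.
rewrite ler_pM ?mulr_ge0 ?norm_szego_le// expr2 ler_pM//.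
Qed.
End Kernel.

(** * Projection onto finitely many kernels *)

Section Projection.
Context {C : numClosedFieldType}.
Implicit Types (z w a : C) (mu : nat -> C).

(** The span of the functions [1 / (z - mu k)] depends only on the set of values of [mu], so each
    value is counted once, at its smallest index. *)
Definition first_occ mu k := [forall j : 'I_k, mu j != mu k].

Definition reduced_prod mu n z : C :=
  \prod_(k < n | first_occ mu k) blaschke (mu k) z.

Lemma reduced_prodS mu n z : reduced_prod mu n.+1 z =
  reduced_prod mu n z * (if first_occ mu n then blaschke (mu n) z else 1).
Proof.
rewrite /reduced_prod [LHS]big_mkcond big_ord_recr/=.
by rewrite [in RHS]big_mkcond.
Qed.

(** Removing the projection onto the kernel at [a] leaves the reproducing kernel of the functions
    vanishing at [a], which is the Szego kernel times a Blaschke factor in each variable. *)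
Lemma szego_blaschke_proj a z w : `|a| < 1 -> `|z| < 1 -> `|w| < 1 ->
  szego z w - szego z a / szego a a * szego a w =
  blaschke a z * (blaschke a w)^* * szego z w.
Proof.
move=> a1 z1 w1; have := szego_blaschke a1 z1 w1.
set b := blaschke a z; set c := (blaschke a w)^* => e.
have -> : b * c * szego z w = szego z w - szego z w * (1 - b * c) by ring.
by rewrite e /szego !invrK normCK [z * a^*]mulrC; ring.
Qed.

(* One Gram-Schmidt step per new point of [mu]; repeated points get the
   coefficient 0. *)
Lemma szego_proj mu n : (forall k, `|mu k| < 1) ->
  exists c : C -> nat -> C, forall z w, `|z| < 1 -> `|w| < 1 ->
    szego z w - \sum_(k < n) c z k * szego (mu k) w =
    reduced_prod mu n z * (reduced_prod mu n w)^* * szego z w.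
Proof.
move=> mu1; elim: n => [|n [c cP]].
  exists (fun _ _ => 0) => z w _ _.
  by rewrite /reduced_prod !big_ord0 subr0 conjC1 !mul1r.
(* The quotient of the current residuals of the kernels at [z] and at [mu n], both evaluated at
   [mu n], with their common conjugate factor cancelled. *)
pose al z := if first_occ mu n then
  reduced_prod mu n z * szego z (mu n) /
  (reduced_prod mu n (mu n) * szego (mu n) (mu n)) else 0.
exists (fun z k => if (k < n)%N then c z k - al z * c (mu n) k else al z).
move=> z w z1 w1; rewrite big_ord_recr/= ltnn.
under eq_bigr do rewrite ltn_ord mulrBl -mulrA.
rewrite sumrB -mulr_sumr opprD opprB.
have -> (x s t K : C) : x + (al z * s - t - al z * K) =
  (x - t) - al z * (K - s) by ring.
rewrite !cP// !reduced_prodS /al; case: ifP => [fresh|_]; last first.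
  by rewrite mul0r subr0 !mulr1.
have b0 : reduced_prod mu n (mu n) != 0.
  apply/prodf_neq0 => k kfresh; rewrite mulf_neq0 ?invr_eq0 ?disc_den_neq0//.
  by rewrite subr_eq0 eq_sym; exact: (forallP fresh).
have K0 : szego (mu n) (mu n) != 0 by rewrite invr_eq0 disc_den_neq0'.
rewrite rmorphM/=; set p := reduced_prod _ _ z; set q := (reduced_prod _ _ w)^*.
have -> : p * blaschke (mu n) z * (q * (blaschke (mu n) w)^*) * szego z w =
  p * q * (blaschke (mu n) z * (blaschke (mu n) w)^* * szego z w) by ring.
rewrite -szego_blaschke_proj//; move: b0 K0.
set b := reduced_prod _ _ _; move=> b0 K0; field.
by rewrite b0 K0.
Qed.

Lemma norm_blaschke_le1 a z : `|a| < 1 -> `|z| < 1 -> `|blaschke a z| <= 1.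
Proof.
move=> a1 z1; have d0 := disc_den_neq0 a1 z1.
rewrite normrM normfV ler_pdivrMr ?normr_gt0// mul1r.
rewrite -(@ler_pXn2r _ 2) ?nnegrE// -subr_ge0 !normCK !rmorphB/= conjC1.
rewrite rmorphM/= conjCK.
have -> : (1 - a^* * z) * (1 - a * z^*) - (z - a) * (z^* - a^*) =
  (1 - a * a^*) * (1 - z * z^*) by ring.
by rewrite -!normCK mulr_ge0// subr_ge0 expr_le1// ltW.
Qed.

(** The dropped factors belong to repeated points and have modulus at most 1. This carries lower
    bounds for full Blaschke products over to repeated poles. *)
Lemma norm_blaschke_prod_le_reduced mu n z : (forall k, `|mu k| < 1) ->
  `|z| < 1 -> `|blaschke_prod mu n z| <= `|reduced_prod mu n z|.
Proof.
move=> mu1 z1; elim: n => [|n IHn].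
  by rewrite /blaschke_prod /reduced_prod !big_ord0.
rewrite reduced_prodS /blaschke_prod big_ord_recr/= [leLHS]normrM [leRHS]normrM.
rewrite ler_pM//; case: ifP => // _; rewrite normr1.
exact: norm_blaschke_le1.
Qed.

Lemma reduced_prod_uniq mu n z : {in gtn n &, injective mu} ->
  reduced_prod mu n z = blaschke_prod mu n z.
Proof.
move=> muI; apply: eq_bigl => k; apply/forallP => j.
apply/negP => /eqP/muI; rewrite !inE ltn_ord.
have jk := ltn_ord j.
by move=> /(_ (ltn_trans jk (ltn_ord k)) isT) e; rewrite e ltnn in jk.
Qed.

Lemma reduced_prod0 mu n k : (k < n)%N -> reduced_prod mu n (mu k) = 0.
Proof.
move=> kn; have ex : exists j, mu j == mu k by exists k.
case: (ex_minnP ex) => j /eqP jk jmin.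
have jn : (j < n)%N by apply: leq_ltn_trans kn; exact: jmin.
rewrite /reduced_prod (bigD1 (Ordinal jn))/= ?jk ?blaschkexx ?mul0r//.
apply/forallP => i; apply/negP; rewrite jk => /jmin.
by rewrite leqNgt ltn_ord.
Qed.
End Projection.

(** * Integrals over the unit circle *)

Section Mean.
Context {R : realType}.
Implicit Types (g h : R -> R) (c : R).

(* [c] is the integral of the smooth function [g] over [-pi, pi], witnessed by a
   primitive. *)
Definition has_mean g c := (forall x : R, derivable g x 1) /\
  exists2 G : R -> R, forall x : R, is_derive x 1 G (g x) & G pi - G (- pi) = c.

Lemma eq_has_mean g h c d :
  g =1 h -> c = d -> has_mean g c -> has_mean h d.
Proof. by move=> /funext -> ->. Qed.

Lemma has_meanD g h c d :
  has_mean g c -> has_mean h d -> has_mean (fun x => g x + h x) (c + d).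
Proof.
move=> [dg [G GP <-]] [dh [H HP <-]]; split=> [x|]; first exact: derivableD.
exists (G + H) => [x|]; last by rewrite !fctE; ring.
exact: is_deriveD.
Qed.

Lemma has_mean_cst c : has_mean (fun=> c) (pi *+ 2 * c).
Proof.
split=> [x|]; first exact: derivable_cst.
exists (fun x => c * x) => [x|]; last by rewrite -mulr_natl; ring.
by have := is_deriveZ c (is_derive_id x (1 : R)); rewrite /GRing.scale/= mulr1.
Qed.

Lemma has_mean_sum (I : Type) (r : seq I) (g : I -> R -> R) (c : I -> R) :
  (forall i, has_mean (g i) (c i)) ->
  has_mean (fun x => \sum_(i <- r) g i x) (\sum_(i <- r) c i).
Proof.
move=> gc; elim: r => [|i r IHr].
  have -> : (fun x => \sum_(i <- [::]) g i x) = fun=> 0.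
    by apply/funext => x; rewrite big_nil.
  by have := has_mean_cst 0; rewrite mulr0 big_nil.
have -> : (fun x => \sum_(j <- i :: r) g j x) =
    fun x => g i x + \sum_(j <- r) g j x.
  by apply/funext => x; rewrite big_cons.
by rewrite big_cons; exact: has_meanD.
Qed.

Lemma has_mean_Rintegral g c : has_mean g c ->
  \int[lebesgue_measure]_(x in `[- pi, pi]) g x = c.
Proof.
move=> [dg [G GP <-]]; rewrite /Rintegral.
have dG (x : R) : derivable G x 1 by exact: ex_derive.
have cG : continuous G.
  by move=> x; exact/differentiable_continuous/derivable1_diffP.
rewrite (@continuous_FTC2 _ g G)//.
- by rewrite gtrN// pi_gt0.
- by apply: derivable_within_continuous => x _; exact: dg.
- split; first by move=> x _; exact: dG.
    exact/cvg_at_right_filter/cG.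
  exact/cvg_at_left_filter/cG.
- by move=> x _; rewrite derive1E derive_val.
Qed.

Lemma has_mean_ge0 g c : has_mean g c -> (forall x, 0 <= g x) -> 0 <= c.
Proof.
by move=> /has_mean_Rintegral <- g0; apply: Rintegral_ge0 => x _; exact: g0.
Qed.

(* With [u + i v = 1 - a e^(i t)], the integrand is the real part of
   [x / (1 - a e^(i t))], and [t - atan (v / u)], [ln (u^2 + v^2) / 2] are the
   primitives of the two components of [1 / (1 - a e^(i t))]. *)
Lemma has_mean_geom (a1 a2 x1 x2 : R) : a1 ^+ 2 + a2 ^+ 2 < 1 ->
  has_mean (fun t =>
    let u := 1 - (a1 * cos t - a2 * sin t) in
    let v := - (a1 * sin t + a2 * cos t) in
    (x1 * u + x2 * v) / (u ^+ 2 + v ^+ 2)) (pi *+ 2 * x1).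
Proof.
move=> a_lt1 /=.
pose u t := 1 - (a1 * cos t - a2 * sin t).
pose v t := - (a1 * sin t + a2 * cos t).
have u0 t : 0 < u t.
  have := cos2Dsin2 t; rewrite /u; set c := cos t; set s := sin t => cs.
  have : (a1 * c - a2 * s) ^+ 2 < 1.
    apply: le_lt_trans a_lt1; rewrite -[leRHS]mulr1 -cs -subr_ge0.
    rewrite (_ : _ - _ = (a1 * s + a2 * c) ^+ 2) ?sqr_ge0//; ring.
  rewrite subr_gt0; set y := _ - _ => y1.
  by rewrite ltNge; apply/negP => y2; nra.
have N0 t : 0 < u t ^+ 2 + v t ^+ 2.
  by rewrite ltr_pwDl ?exprn_gt0// sqr_ge0.
have du (t : R) : is_derive t 1 u (- v t).
  rewrite /u /v; apply: is_derive_eq; rewrite /GRing.scale/=; ring.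
have dv (t : R) : is_derive t 1 v (u t - 1).
  rewrite /u /v; apply: is_derive_eq; rewrite /GRing.scale/=; ring.
have dN (t : R) : is_derive t 1 (fun t => u t ^+ 2 + v t ^+ 2) (- (v t) *+ 2).
  apply: is_derive_eq; rewrite /GRing.scale/=; ring.
have dVu (t : R) : is_derive t 1 (fun t => (u t)^-1) (v t / u t ^+ 2).
  apply: is_derive_eq; first by apply: is_deriveV; rewrite gt_eqF.
  by rewrite /GRing.scale/=; ring.
have dVN (t : R) : derivable (fun t => (u t ^+ 2 + v t ^+ 2)^-1) t 1.
  by apply: ex_derive; apply: is_deriveV; rewrite gt_eqF.
have dq (t : R) : is_derive t 1 (fun t => v t / u t)
    ((u t ^+ 2 + v t ^+ 2 - u t) / u t ^+ 2).
  apply: (is_derive_eq (is_deriveM (dv t) (dVu t))).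
  by rewrite /GRing.scale/=; field; rewrite gt_eqF.
have dat (t : R) : is_derive t 1 (fun t => atan (v t / u t))
    (1 - u t / (u t ^+ 2 + v t ^+ 2)).
  apply: (is_derive_eq (is_derive1_comp (is_derive1_atan _) (dq t))).
  move: (u0 t) (N0 t); move: (u t) (v t) => a b a0 ab0 /=; field.
  by rewrite !gt_eqF.
have dln (t : R) : is_derive t 1 (fun t => ln (u t ^+ 2 + v t ^+ 2))
    (- (v t) *+ 2 / (u t ^+ 2 + v t ^+ 2)).
  apply: (is_derive_eq (@is_derive1_comp _ _ (fun t => u t ^+ 2 + v t ^+ 2) _ _ _
    (is_derive1_ln (N0 t)) (dN t))).
  by rewrite /= mulrC.
split=> [t|].
  by apply: derivableM => //; apply: derivableD; apply: derivableM => //;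
    exact: ex_derive.
exists (fun t => x1 * (t - atan (v t / u t)) - x2 * (ln (u t ^+ 2 + v t ^+ 2) / 2)).
  move=> t; apply: is_derive_eq; rewrite -/(u t) -/(v t) /GRing.scale/=.
  by move: (N0 t); move: (u t) (v t) => a b ab0; field; rewrite gt_eqF.
(* [u] and [v] agree at both ends, so only the linear term [x1 * t] of the primitive contributes. *)
have -> : u (- pi) = u pi by rewrite /u cosN sinN sinpi oppr0.
have -> : v (- pi) = v pi by rewrite /v cosN sinN sinpi oppr0.
ring.
Qed.
End Mean.

Section ComplexBasics.
Context {R : realType}.
Implicit Types (x y z : R[i]).

Lemma normrE z : `|z| = (cabs z)%:C%C.
Proof. by case: z. Qed.

Lemma conjE z : z^* = (complex.Re z -i* complex.Im z)%C.
Proof. by case: z. Qed.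

Lemma Re_conj z : complex.Re (z^*) = complex.Re z.
Proof. by rewrite conjE. Qed.

Lemma ReD x y : complex.Re (x + y) = complex.Re x + complex.Re y.
Proof. by case: x y => ? ? []. Qed.

Lemma ReN x : complex.Re (- x) = - complex.Re x.
Proof. by case: x. Qed.

Lemma Re_sum (I : Type) (r : seq I) (P : pred I) (F : I -> R[i]) :
  complex.Re (\sum_(i <- r | P i) F i) = \sum_(i <- r | P i) complex.Re (F i).
Proof. by apply: (big_morph _ ReD). Qed.

Lemma disc_norm z : disc z -> `|z| < 1.
Proof. by rewrite /disc/= normrE -(rmorph1 (real_complex R)) ltcR. Qed.

Lemma cabs_ge0 z : 0 <= cabs z.
Proof. by case: z => a b; exact: sqrtr_ge0. Qed.

Lemma cabsM x y : cabs (x * y) = cabs x * cabs y.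
Proof. exact: Normc.normcM. Qed.

Lemma cabs_sqr z : cabs z ^+ 2 = complex.Re z ^+ 2 + complex.Im z ^+ 2.
Proof. by case: z => a b; rewrite sqr_sqrtr// addr_ge0// sqr_ge0. Qed.

Lemma Re_le_cabs z : complex.Re z <= cabs z.
Proof.
case: z => a b; rewrite /cabs/= (le_trans (ler_norm _))//.
by rewrite -sqrtr_sqr ler_wsqrtr// lerDl sqr_ge0.
Qed.

Lemma cabs_mulconj z : z * z^* = (cabs z ^+ 2)%:C%C.
Proof. by rewrite -normCK normrE rmorphXn. Qed.

End ComplexBasics.

Section HardyProduct.
Context {R : realType}.
Implicit Types (f g : R[i] -> R[i]) (x y a b : R[i]).

Definition cis (t : R) : R[i] := (cos t +i* sin t)%C.

Lemma cis_mulconj t : cis t * (cis t)^* = 1.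
Proof. by rewrite cabs_mulconj cabs_sqr/= cos2Dsin2. Qed.

Lemma has_mean_cauchy a x : `|a| < 1 ->
  has_mean (fun t => complex.Re (x / (1 - a * cis t))) (pi *+ 2 * complex.Re x).
Proof.
rewrite normrE -(rmorph1 (real_complex R)) ltcR -(@expr_lt1 _ 2)// ?cabs_ge0//.
rewrite cabs_sqr; case: a x => a1 a2 [x1 x2] /(has_mean_geom x1 x2).
by apply: eq_has_mean => // t /=; rewrite sub0r; ring.
Qed.

(* [y] is the inner product of [f] and [g] in the Hardy space of the circle; the
   factor [x] encodes the real and imaginary parts of the integral at once. *)
Definition hardy_dot f g y := forall x : R[i],
  has_mean (fun t => complex.Re (x * (f (cis t) * (g (cis t))^*)))
           (pi *+ 2 * complex.Re (x * y)).

Lemma hardy_dotC f g y : hardy_dot f g y -> hardy_dot g f y^*.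
Proof.
move=> fg x; apply: eq_has_mean (fg x^* ).
  move=> t; rewrite -[LHS]Re_conj; congr complex.Re.
  by rewrite !rmorphM/= !conjCK; ring.
by rewrite -[in LHS]Re_conj rmorphM/= conjCK.
Qed.

Lemma hardy_dotDl f1 f2 g y1 y2 : hardy_dot f1 g y1 -> hardy_dot f2 g y2 ->
  hardy_dot (fun z => f1 z + f2 z) g (y1 + y2).
Proof.
move=> f1g f2g x; apply: eq_has_mean (has_meanD (f1g x) (f2g x)).
  by move=> t; rewrite -ReD; congr complex.Re; ring.
by rewrite -mulrDr -ReD mulrDr.
Qed.

Lemma hardy_dotZl a f g y : hardy_dot f g y ->
  hardy_dot (fun z => a * f z) g (a * y).
Proof.
move=> fg x; apply: eq_has_mean (fg (x * a)).
  by move=> t; congr complex.Re; ring.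
by rewrite mulrA.
Qed.

Lemma hardy_dot_suml (I : Type) (r : seq I) (f : I -> R[i] -> R[i]) g
    (y : I -> R[i]) : (forall i, hardy_dot (f i) g (y i)) ->
  hardy_dot (fun z => \sum_(i <- r) f i z) g (\sum_(i <- r) y i).
Proof.
move=> fg x; apply: eq_has_mean (has_mean_sum r (fun i => fg i x)).
  by move=> t; rewrite -Re_sum -mulr_sumr -mulr_suml.
by rewrite -mulr_sumr -Re_sum -mulr_sumr.
Qed.

(** On the circle the product of the two functions is [1 / ((1 - a / z) (1 - b' z))] with [b'] the
    conjugate of [b]. Partial fractions turn it into [szego a b] times
    [1 / (1 - a / z) + 1 / (1 - b' z) - 1], and each of the two fractions has mean 1. *)
Lemma hardy_dot_szego a b : `|a| < 1 -> `|b| < 1 ->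
  hardy_dot (fun z => (z - a)^-1) (fun z => (z - b)^-1) (szego a b).
Proof.
move=> a1 b1 x; have [y defy] : exists y, y = x * szego a b by eexists.
rewrite -defy.
have ha : `|a^*| < 1 by rewrite norm_conjC.
have hb : `|b^*| < 1 by rewrite norm_conjC.
apply: eq_has_mean (has_meanD (has_meanD (has_mean_cauchy y^* ha)
  (has_mean_cauchy y hb)) (has_mean_cst (- complex.Re y))); last first.
  by rewrite Re_conj mulrN addrK.
move=> t.
rewrite -[X in X + _ + _]Re_conj -ReN -!ReD; congr complex.Re.
have cc := cis_mulconj t; move: cc; move: (cis t) => z cc.
have z1 : `|z| = 1 by apply/eqP; rewrite -(@eqrXn2 _ 2)// normCK cc expr1n.
have z0 : z != 0 by rewrite -normr_gt0 z1.
have -> : (y^* / (1 - a^* * z))^* = y / (1 - a / z).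
  rewrite rmorphM fmorphV rmorphB /= conjC1 rmorphM/= !conjCK.
  by rewrite -[z^*](mulKf z0) cc mulr1.
rewrite fmorphV rmorphB/= -[z^*](mulKf z0) cc mulr1.
have za : z - a != 0.
  by rewrite subr_eq0; apply: contraTneq a1 => <-; rewrite z1 ltxx.
have zb : 1 - b^* * z != 0.
  rewrite subr_eq0; apply: contraTneq b1 => e.
  have b_1 : `|b| = 1 by rewrite -norm_conjC -[LHS]mulr1 -z1 -normrM -e normr1.
  by rewrite b_1 ltxx.
have ab := disc_den_neq0' a1 b1; rewrite defy /szego; move: (b^*) zb ab => b' zb ab.

by field; rewrite mulNr z0 za ab zb.
Qed.

End HardyProduct.

(** * The minimal fitting error *)

Section FitError.
Context {R : realType} (p m : nat).
Implicit Types (mu : nat -> R[i]).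

(** The squared norm of a combination of scalar functions with matrix coefficients [A], when [gam]
    is the Gram matrix of these functions. *)
Definition gram (I : finType) (A : I -> 'M[R[i]]_(p, m)) (gam : I -> I -> R[i]) :=
  complex.Re (\sum_s \sum_t \tr (A s *m (A t)^t*) * gam s t).

Lemma mxtrace_sum n (I : Type) (r : seq I) (A : I -> 'M[R[i]]_n) :
  \tr (\sum_(i <- r) A i) = \sum_(i <- r) \tr (A i).
Proof. exact: (big_morph _ (@mxtraceD _ _) (@mxtrace0 _ _)). Qed.

Lemma has_mean_h2 (I : finType) (g : I -> R[i] -> R[i]) (A : I -> 'M[R[i]]_(p, m))
    (gam : I -> I -> R[i]) :
  (forall s t, hardy_dot (g s) (g t) (gam s t)) ->
  let F z := \sum_s g s z *: A s in
  has_mean (fun w => complex.Re (\tr (F (cis w) *m (F (cis w))^t*)))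
    (pi *+ 2 * gram A gam).
Proof.
move=> gP F.
have := has_mean_sum (index_enum I) (fun s => has_mean_sum (index_enum I)
  (fun t => gP s t (\tr (A s *m (A t)^t*)))).
apply: eq_has_mean => [w|]; last first.
  rewrite /gram Re_sum mulr_sumr; apply: eq_bigr => s _.
  by rewrite Re_sum mulr_sumr.
have -> : (F (cis w))^t* = \sum_t (g t (cis w))^* *: (A t)^t*.
  apply/matrixP => i j; rewrite !mxE !summxE rmorph_sum; apply: eq_bigr => t _.
  by rewrite !mxE rmorphM.
rewrite /F mulmx_suml mxtrace_sum Re_sum; apply: eq_bigr => s _.
rewrite mulmx_sumr mxtrace_sum Re_sum; apply: eq_bigr => t _.
by rewrite -scalemxAl -scalemxAr !mxtraceZ mulrC -mulrA.
Qed.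

Lemma h2norm_sum (I : finType) (g : I -> R[i] -> R[i]) (A : I -> 'M[R[i]]_(p, m))
    (gam : I -> I -> R[i]) :
  (forall s t, hardy_dot (g s) (g t) (gam s t)) ->
  0 <= gram A gam /\
  h2norm (fun z => \sum_s g s z *: A s) = Num.sqrt (gram A gam).
Proof.
move=> gP; have h := has_mean_h2 A gP.
have pi2 : 0 < pi *+ 2 :> R by rewrite pmulrn_lgt0 ?pi_gt0.
split.
  rewrite -(pmulr_rge0 _ pi2); apply: has_mean_ge0 h _ => w.
  set M := \sum_s _; rewrite /mxtrace Re_sum; apply: sumr_ge0 => i _.
  rewrite mxE Re_sum; apply: sumr_ge0 => j _.
  by rewrite !mxE cabs_mulconj /= sqr_ge0.
rewrite /h2norm (has_mean_Rintegral h) mulKf//.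
by rewrite gt_eqF.
Qed.

(** Each [1 / (z - lam j)] is split into a combination of the [1 / (z - mu k)] and a residual
    [r (lam j)] orthogonal to them, with the coefficients of [szego_proj]. By Pythagoras the fitted
    residues only affect the first component, which they can cancel. *)
Lemma fit_errors_min n q mu (lam : 'I_n -> R[i])
    (A : 'I_n -> 'M[R[i]]_(p, m)) :
  (forall k, `|mu k| < 1) -> (forall j, `|lam j| < 1) ->
  is_min (fit_errors (fun k : 'I_q => mu k) (pole_sum lam A))
    (Num.sqrt (gram A (fun j l => reduced_prod mu q (lam j) *
       (reduced_prod mu q (lam l))^* * szego (lam j) (lam l))) `^ q%:R^-1).
Proof.
move=> mu1 lam1; have [c cP] := szego_proj q mu1.
set gam := fun j l : 'I_n => _.
pose r a z : R[i] := (z - a)^-1 + \sum_(k < q) - c a k * (z - mu k)^-1.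
have rP a f (y : R[i] -> R[i]) : `|a| < 1 ->
    (forall b, `|b| < 1 -> hardy_dot (fun z => (z - b)^-1) f (y b)) ->
    hardy_dot (r a) f (y a - \sum_(k < q) c a k * y (mu k)).
  move=> a1 yP; rewrite -sumrN; under eq_bigr do rewrite -mulNr.
  have hs := hardy_dot_suml (index_enum 'I_q)
    (fun k => hardy_dotZl (- c a (nat_of_ord k)) (yP _ (mu1 k))).
  exact: hardy_dotDl (yP _ a1) hs.
pose rk a b := reduced_prod mu q a * (reduced_prod mu q b)^* * szego a b.
have r1 a b : `|a| < 1 -> `|b| < 1 ->
    hardy_dot (r a) (fun z => (z - b)^-1) (rk a b).
  move=> a1 b1; rewrite /rk -cP//.
  apply: (rP _ _ (fun a => szego a b)) => // a' a'1.
  exact: hardy_dot_szego.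
have mu0 (k : 'I_q) : reduced_prod mu q (mu k) = 0.
  exact: reduced_prod0.
have r2 a (k : 'I_q) : `|a| < 1 -> hardy_dot (r a) (fun z => (z - mu k)^-1) 0.
  by move=> a1; have := r1 a _ a1 (mu1 k); rewrite /rk mu0 conjC0 mulr0 mul0r.
(* As [r a] is orthogonal to every [1 / (z - mu k)], the terms subtracted in [r b] do not change the
   product. *)
have r3 a b : `|a| < 1 -> `|b| < 1 -> hardy_dot (r a) (r b) (rk a b).
  move=> a1 b1; rewrite -[rk a b]conjCK; apply: hardy_dotC.
  have -> : (rk a b)^* = (rk a b)^* - \sum_(k < q) c b k * (rk a (mu k))^*.
    rewrite big1 ?subr0// => k _.
    by rewrite /rk mu0 conjC0 mulr0 mul0r conjC0 mulr0.
  apply: (rP _ _ (fun x => (rk a x)^* )) => // x x1.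
  by apply: hardy_dotC; exact: r1.
(* In the family of residuals followed by the [1 / (z - mu k)], the Gram matrix [gm] is block
   diagonal; [T S] below lists the coefficients of the error in this family. *)
pose g (s : 'I_n + 'I_q) z := match s with
  inl j => r (lam j) z | inr k => (z - mu k)^-1 end.
pose gm (s t : 'I_n + 'I_q) := match s, t with
  | inl j, inl l => gam j l
  | inr k, inr i => szego (mu k) (mu i)
  | _, _ => 0 end.
have gP s t : hardy_dot (g s) (g t) (gm s t).
  case: s t => [j|k] [l|i]; [exact: r3|exact: r2| |exact: hardy_dot_szego].
  by rewrite /gm -conjC0; apply: hardy_dotC; exact: r2.
pose T (S : 'I_q -> 'M[R[i]]_(p, m)) (s : 'I_n + 'I_q) := match s with
  inl j => A j | inr k => \sum_j c (lam j) k *: A j - S k end.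
have fitE S : h2norm (fun z => pole_sum lam A z - pole_sum (fun k : 'I_q => mu
  k) S z) =
    Num.sqrt (gram (T S) gm).
  have [_ <-] := h2norm_sum (T S) gP; congr h2norm; apply/funext => z.
  rewrite big_sumType/= /pole_sum /r.
  under [in RHS]eq_bigr do rewrite scalerDl scaler_suml.
  rewrite big_split/= -addrA; congr (_ + _).
  rewrite exchange_big -big_split -sumrN/=; apply: eq_bigr => k _.
  rewrite scalerBr addrA -[LHS]add0r; congr (_ - _).
  rewrite scaler_sumr -big_split big1//= => j _.
  by rewrite scalerA -scalerDl mulNr [X in _ + X]mulrC addNr scale0r.
have gramE S : gram (T S) gm = gram A gam +
    gram (T S \o inr) (fun k i : 'I_q => szego (mu k) (mu i)).
  rewrite /gram -ReD !big_sumType/=; congr (complex.Re (_ + _)).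
    apply: eq_bigr => j _; rewrite big_sumType/= [X in _ + X]big1 ?addr0//.
    by move=> k _; rewrite mulr0.
  apply: eq_bigr => k _; rewrite big_sumType/= big1 ?add0r//.
  by move=> j _; rewrite mulr0.
split.
  (* The residues that cancel the second block of coefficients. *)
  pose S0 (k : 'I_q) := \sum_j c (lam j) k *: A j.
  exists S0 => //; rewrite fitE gramE (_ : gram (T S0 \o inr) _ = 0) ?addr0//.
  rewrite /gram big1// => k _; rewrite big1// => i _.
  by rewrite /= subrr mul0mx mxtrace0 mul0r.
move=> _ [S _ <-]; rewrite fitE gramE; apply: ge0_ler_powR.
- by rewrite invr_ge0.
- by rewrite nnegrE sqrtr_ge0.
- by rewrite nnegrE sqrtr_ge0.
apply: ler_wsqrtr; rewrite lerDl.
by have [] := h2norm_sum (T S \o inr) (fun k i : 'I_q => hardy_dot_szego (mu1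
  k) (mu1 i)).
Qed.
End FitError.

(** Lagrange's identity: twice the difference is the double sum of
    [(a i * b j - a j * b i) ^+ 2]. *)
Lemma cauchy_schwarz_sum (R : realFieldType) (I : finType) (a b : I -> R) :
  (\sum_i a i * b i) ^+ 2 <= (\sum_i a i ^+ 2) * \sum_i b i ^+ 2.
Proof.
rewrite -subr_ge0 -(pmulr_rge0 _ (ltr0n R 2)) mulr_natl mulr2n.
rewrite -[X in X - _ + _](mulrC (\sum_i b i ^+ 2)) expr2 !big_distrlr/=.
rewrite addrACA -opprD -!big_split -sumrB/=; apply: sumr_ge0 => i _.
rewrite -!big_split -sumrB/=; apply: sumr_ge0 => j _.
by rewrite (_ : _ - _ = (a i * b j - a j * b i) ^+ 2) ?sqr_ge0//; ring.
Qed.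

(** * The worst system has a single pole *)

Section MaxError.
Context {R : realType} (p m : nat).
Implicit Types (mu : nat -> R[i]) (A B : 'M[R[i]]_(p, m)).

Lemma cabs_sum_le (I : Type) (r : seq I) (F : I -> R[i]) :
  cabs (\sum_(i <- r) F i) <= \sum_(i <- r) cabs (F i).
Proof.
rewrite -lecR -normrE rmorph_sum/=; apply: le_trans (ler_norm_sum _ _ _) _.
by apply: ler_sum => i _; rewrite normrE.
Qed.

Lemma cabs_conj (z : R[i]) : cabs z^* = cabs z.
Proof. by apply: complexI; rewrite -!normrE norm_conjC. Qed.

Lemma cabsV (z : R[i]) : cabs z^-1 = (cabs z)^-1.
Proof. exact: Normc.normcV. Qed.

Lemma cabs0 : cabs (0 : R[i]) = 0.
Proof. by apply: complexI; rewrite -normrE normr0. Qed.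

Lemma frob_ge0 A : 0 <= frob A.
Proof. exact: sqrtr_ge0. Qed.

Lemma frob_sqr A : frob A ^+ 2 = \sum_i \sum_j cabs (A i j) ^+ 2.
Proof.
by rewrite sqr_sqrtr// sumr_ge0// => i _; rewrite sumr_ge0// => j _; rewrite sqr_ge0.
Qed.

Lemma mxtrace_mul_trC A B :
  \tr (A *m B^t*) = \sum_i \sum_j A i j * (B i j)^*.
Proof.
by apply: eq_bigr => i _; rewrite mxE; apply: eq_bigr => j _; rewrite !mxE.
Qed.

Lemma mxtrace_frob A : \tr (A *m A^t*) = (frob A ^+ 2)%:C%C.
Proof.
rewrite mxtrace_mul_trC frob_sqr rmorph_sum; apply: eq_bigr => i _.
by rewrite rmorph_sum; apply: eq_bigr => j _; rewrite cabs_mulconj.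
Qed.

Lemma cabs_mxtrace_le A B : cabs (\tr (A *m B^t*)) <= frob A * frob B.
Proof.
rewrite mxtrace_mul_trC; apply: (@le_trans _ _ (\sum_i \sum_j cabs (A i j) *
  cabs (B i j))).
  apply: le_trans (cabs_sum_le _ _) _; apply: ler_sum => i _.
  apply: le_trans (cabs_sum_le _ _) _; apply: ler_sum => j _.
  by rewrite cabsM cabs_conj.
rewrite -(@ler_pXn2r _ 2) ?nnegrE ?mulr_ge0 ?frob_ge0//; last first.
  by apply: sumr_ge0 => i _; apply: sumr_ge0 => j _; rewrite mulr_ge0 ?cabs_ge0.
rewrite exprMn !frob_sqr !pair_bigA; exact: cauchy_schwarz_sum.
Qed.

(** Cauchy-Schwarz for the kernel. After squaring, the gap between the two denominators is exactly
    [|a - b|^2]. *)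
Lemma cabs_szego_le (a b : R[i]) : disc a -> disc b ->
  cabs (szego a b) <=
  (Num.sqrt (1 - cabs a ^+ 2))^-1 * (Num.sqrt (1 - cabs b ^+ 2))^-1.
Proof.
move=> a1 b1.
have pos (z : R[i]) : disc z -> 0 < 1 - cabs z ^+ 2.
  by move=> z1; rewrite subr_gt0 expr_lt1 ?cabs_ge0.
have d0 : 0 < cabs (1 - a * b^*).
  rewrite -ltcR -normrE normr_gt0.
  by apply: disc_den_neq0'; exact: disc_norm.
rewrite cabsV -invfM -sqrtrM ?(ltW (pos _ a1))// lef_pV2 ?posrE//; last first.
  by rewrite sqrtr_gt0 mulr_gt0 ?pos.
rewrite -[leRHS]gtr0_norm// -sqrtr_sqr ler_wsqrtr// -subr_ge0.
have -> : cabs (1 - a * b^*) ^+ 2 - (1 - cabs a ^+ 2) * (1 - cabs b ^+ 2) =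
    cabs (a - b) ^+ 2.
  rewrite !cabs_sqr conjE; case: a b {a1 b1 d0} => [a1 a2] [b1 b2] /=; ring.
exact: sqr_ge0.
Qed.

(** The distance in H2 from [1 / (x - z)], as a function of [x], to the span of the first [q]
    functions [1 / (x - mu k)]. *)
Definition pole_error mu q (z : R[i]) : R :=
  cabs (reduced_prod mu q z) / Num.sqrt (1 - cabs z ^+ 2).

(** The triangle inequality in squared form: the double sum is bounded term by term, the traces by
    Cauchy-Schwarz and the kernels by [cabs_szego_le]. *)
Lemma gram_le n mu q (lam : 'I_n -> R[i]) (A : 'I_n -> 'M[R[i]]_(p, m)) :
  (forall j, disc (lam j)) ->
  gram A (fun j l => reduced_prod mu q (lam j) *
       (reduced_prod mu q (lam l))^* * szego (lam j) (lam l)) <=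
  (\sum_j frob (A j) * pole_error mu q (lam j)) ^+ 2.
Proof.
move=> lam1; rewrite /gram Re_sum expr2 big_distrlr/=; apply: ler_sum => j _.
rewrite Re_sum; apply: ler_sum => l _; apply: le_trans (Re_le_cabs _) _.
rewrite !cabsM cabs_conj /pole_error.
set s := (_ _ * cabs (szego _ _)).
rewrite mulrACA ler_pM ?cabs_ge0// ?mulr_ge0 ?cabs_ge0//;
  first exact: cabs_mxtrace_le.
rewrite /s mulrACA ler_wpM2l ?mulr_ge0 ?cabs_ge0//; exact: cabs_szego_le.
Qed.

Lemma gram1 mu q (z : R[i]) A : disc z ->
  gram (fun _ : 'I_1 => A) (fun j l => reduced_prod mu q z *
       (reduced_prod mu q z)^* * szego z z) = (frob A * pole_error mu q z) ^+ 2.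
Proof.
move=> z1; rewrite /gram !big_ord1 mxtrace_frob cabs_mulconj /szego cabs_mulconj.
rewrite -(rmorph1 (real_complex R)) -rmorphB -fmorphV -!rmorphM/= /pole_error.
have z2 : 0 <= 1 - cabs z ^+ 2 by rewrite subr_ge0 expr_le1 ?cabs_ge0// ltW.
by rewrite !exprMn exprVn (sqr_sqrtr z2) !mulrA.
Qed.

Lemma is_min_inj (S : set R) x y : is_min S x -> is_min S y -> x = y.
Proof.
by move=> [Sx lx] [Sy ly]; apply/eqP; rewrite eq_le lx//= ly.
Qed.

(** The bound [gram_le] is linear in the norms of the residues, so it is largest when the whole
    budget [Rbar] sits at a maximizer of [pole_error]; [gram1] shows that this value is attained. *)
Lemma is_maxmin_errorP (D : set R[i]) Rbar mu q z : (0 < p)%N -> (0 < m)%N ->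
  D `<=` @disc R -> 0 < Rbar -> (forall k, disc (mu k)) ->
  D z -> (forall w, D w -> pole_error mu q w <= pole_error mu q z) ->
  is_maxmin_error D Rbar p m (fun k : 'I_q => mu k)
    ((Rbar * pole_error mu q z) `^ q%:R^-1).
Proof.
move=> p0 m0 Dd Rbar0 mu1 Dz zmax.
(* The default 0 is never taken on the class, since [fit_errors_min] provides a minimum there. *)
pose best (G : R[i] -> 'M[R[i]]_(p, m)) :=
  xget 0 [set x | is_min (fit_errors (fun k : 'I_q => mu k) G) x].
have mu1' k : `|mu k| < 1 by exact: disc_norm.
have bestE n (lam : 'I_n -> R[i]) (A : 'I_n -> 'M[R[i]]_(p, m)) : (forall j, D
  (lam j)) ->
  best (pole_sum lam A) = Num.sqrt (gram A (fun j l => reduced_prod mu q (lam j) *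
       (reduced_prod mu q (lam l))^* * szego (lam j) (lam l))) `^ q%:R^-1 /\
  is_min (fit_errors (fun k : 'I_q => mu k) (pole_sum lam A))
    (best (pole_sum lam A)).
  move=> Dlam.
  have h := fit_errors_min q A mu1' (fun j => disc_norm (Dd _ (Dlam j))).
  have b : is_min (fit_errors (fun k : 'I_q => mu k) (pole_sum lam A))
      (best (pole_sum lam A)).
    exact: (xgetPex _ (ex_intro _ _ h)).
  by split => //; exact: is_min_inj b h.
exists best.
  by move=> _ [n [lam [A [_ Dlam _ ->]]]]; have [] := bestE _ lam A Dlam.
split.
  pose A0 : 'M[R[i]]_(p, m) := Rbar%:C%C *: delta_mx (Ordinal p0) (Ordinal m0).
  have fA0 : frob A0 = Rbar.
    rewrite -[RHS]gtr0_norm// -sqrtr_sqr; congr Num.sqrt.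
    rewrite (bigD1 (Ordinal p0))//= [X in _ + X]big1 ?addr0; last first.
      move=> i /negPf i0; apply: big1 => j _; rewrite !mxE i0 mulr0.
      by rewrite cabs0 expr0n.
    rewrite (bigD1 (Ordinal m0))//= [X in _ + X]big1 ?addr0; last first.
      by move=> j /negPf j0; rewrite !mxE j0 andbF mulr0 cabs0 expr0n.
    by rewrite !mxE !eqxx mulr1 cabs_sqr/= expr0n/= addr0.
  exists (pole_sum (fun _ : 'I_1 => z) (fun=> A0)).
    exists 1%N, (fun=> z), (fun=> A0); split => //.
    - by move=> i j _; rewrite !ord1.
    - by rewrite big_ord1 fA0.
  have [-> _] := bestE _ (fun _ : 'I_1 => z) (fun=> A0) (fun=> Dz).
  rewrite gram1; last exact: Dd.
  rewrite sqrtr_sqr fA0 ger0_norm// mulr_ge0 ?(ltW Rbar0)//.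
  by rewrite mulr_ge0 ?cabs_ge0// invr_ge0 sqrtr_ge0.
move=> _ [_ [n [lam [A [_ Dlam fA ->]]]] <-].
have [-> _] := bestE _ lam A Dlam.
have pe0 w : 0 <= pole_error mu q w.
  by rewrite mulr_ge0 ?cabs_ge0// invr_ge0 sqrtr_ge0.
apply: ge0_ler_powR.
- by rewrite invr_ge0.
- by rewrite nnegrE sqrtr_ge0.
- by rewrite nnegrE mulr_ge0// ltW.
apply: (@le_trans _ _ (\sum_j frob (A j) * pole_error mu q (lam j))).
  rewrite -[leRHS]ger0_norm; last by apply: sumr_ge0 => j _;
    rewrite mulr_ge0 ?frob_ge0.
  rewrite -sqrtr_sqr; apply: ler_wsqrtr; apply: gram_le => j.
  exact/Dd/Dlam.
apply: (@le_trans _ _ ((\sum_j frob (A j)) * pole_error mu q z)).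
  by rewrite mulr_suml; apply: ler_sum => j _; rewrite ler_wpM2l ?frob_ge0 ?zmax.
by rewrite ler_wpM2r.
Qed.
End MaxError.

(** * Tsuji products *)

Section Tsuji.
Context {R : realType}.
Implicit Types (z w : R[i]) (D : set R[i]).

Lemma hdistE z w : hdist z w = cabs (blaschke w z).
Proof. by []. Qed.

Lemma hdist_ge0 z w : 0 <= hdist z w.
Proof. exact: cabs_ge0. Qed.

Lemma hdist_le1 z w : disc z -> disc w -> hdist z w <= 1.
Proof.
move=> z1 w1; rewrite -lecR -normrE rmorph1.
by apply: norm_blaschke_le1; exact: disc_norm.
Qed.

Lemma hdistC z w : hdist z w = hdist w z.
Proof.
rewrite /hdist !cabsM !cabsV; congr (_ / _).
  by apply: complexI; rewrite -!normrE distrC.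
by rewrite -[LHS]cabs_conj rmorphB rmorphM/= conjCK conjC1 mulrC.
Qed.

Lemma hdist_gt0 z w : disc z -> disc w -> z != w -> 0 < hdist z w.
Proof.
move=> z1 w1 zw; rewrite -ltcR -normrE normr_gt0.
by rewrite mulf_neq0 ?subr_eq0// invr_eq0 disc_den_neq0//; exact: disc_norm.
Qed.

Definition tsuji_prod q (z : 'I_q -> R[i]) : R :=
  \prod_(k < q) \prod_(j < q | (j < k)%N) hdist (z j) (z k).

Lemma tsuji_prod_ge0 q (z : 'I_q -> R[i]) : 0 <= tsuji_prod z.
Proof.
by apply: prodr_ge0 => k _; apply: prodr_ge0 => j _; exact: hdist_ge0.
Qed.

Lemma tsuji_prod_le1 q (z : 'I_q -> R[i]) : (forall k, disc (z k)) ->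
  tsuji_prod z <= 1.
Proof.
move=> z1; apply: prodr_ile1 => k _; rewrite prodr_ge0 => [|j _]; last first.
  exact: hdist_ge0.
by apply: prodr_ile1 => j _; rewrite hdist_ge0 hdist_le1.
Qed.

Lemma tsuji_prod_gt0 q (z : 'I_q -> R[i]) : (forall k, disc (z k)) ->
  injective z -> 0 < tsuji_prod z.
Proof.
move=> z1 zI; apply: prodr_gt0 => k _; apply: prodr_gt0 => j jk.
by apply: hdist_gt0 => //; apply: contraTneq jk => /zI ->; rewrite ltnn.
Qed.

Lemma tsuji_prod_neq0_inj q (z : 'I_q -> R[i]) : tsuji_prod z != 0 ->
  injective z.
Proof.
move=> z0 i j zij; apply/eqP; apply: contraNT z0 => ij.
wlog lt_ij : i j zij ij / (i < j)%N.
  move=> h; have [/h|lt_ji|e] := ltngtP i j; first exact.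
    by apply: (h j i) => //; rewrite eq_sym.
  by case/eqP: ij; exact/val_inj.
apply/eqP/eqP/prodf_eq0; exists j => //; apply/prodf_eq0; exists i => //.
by rewrite zij hdistE blaschkexx cabs0.
Qed.

Definition extend q (z : 'I_q -> R[i]) w (i : 'I_q.+1) : R[i] :=
  if unlift ord_max i is Some j then z j else w.

Lemma tsuji_prod_extend q (z : 'I_q -> R[i]) w :
  tsuji_prod (extend z w) = tsuji_prod z * \prod_(k < q) hdist w (z k).
Proof.
have lastE : extend z w ord_max = w by rewrite /extend unlift_none.
have liftE (k : 'I_q) : extend z w (widen_ord (leqnSn q) k) = z k.
  have -> : widen_ord (leqnSn q) k = lift ord_max k.
    by apply/val_inj; rewrite /= /bump leqNgt ltn_ord.
  by rewrite /extend liftK.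
rewrite /tsuji_prod big_ord_recr/=; congr (_ * _).
  apply: eq_bigr => k _; rewrite big_mkcond big_ord_recr/= ltnNge ltnW//= mulr1.
  by rewrite -big_mkcond/=; apply: eq_bigr => j _; rewrite !liftE.
rewrite big_mkcond big_ord_recr/= ltnn mulr1; apply: eq_bigr => k _.
by rewrite ltn_ord liftE lastE hdistC.
Qed.

Lemma tsuji_prod_sqr q (z : 'I_q -> R[i]) :
  tsuji_prod z ^+ 2 =
  \prod_k \prod_j (if j == k then 1 else hdist (z j) (z k)).
Proof.
rewrite expr2 {2}/tsuji_prod.
under [X in _ * X]eq_bigr do rewrite big_mkcond.
rewrite exchange_big/= /tsuji_prod -big_split; apply: eq_bigr => k _.
rewrite big_mkcond -big_split; apply: eq_bigr => j _ /=.
have [jk|kj|/val_inj ->] := ltngtP j k.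
- by rewrite mulr1 -val_eqE/= ltn_eqF.
- by rewrite mul1r -val_eqE/= gtn_eqF// hdistC.
- by rewrite eqxx mulr1.
Qed.

Lemma prod_lift q (i : 'I_q.+1) (F : 'I_q.+1 -> R) :
  \prod_k F (lift i k) = \prod_(k | k != i) F k.
Proof.
rewrite [RHS]big_mkcond (bigD1_ord i)//= eqxx mul1r.
by apply: eq_bigr => k _; rewrite eq_sym neq_lift.
Qed.

(* Every pair of points survives in [q - 1] of the [q + 1] deletions. *)
Lemma prod_tsuji_prod_lift q (z : 'I_q.+1 -> R[i]) :
  \prod_i tsuji_prod (z \o lift i) ^+ 2 = (tsuji_prod z ^+ 2) ^+ q.-1.
Proof.
pose y j k := if j == k then 1 else hdist (z j) (z k).
have -> : \prod_i tsuji_prod (z \o lift i) ^+ 2 =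
    \prod_i \prod_k \prod_j (if (k != i) && (j != i) then y j k else 1).
  apply: eq_bigr => i _; rewrite tsuji_prod_sqr.
  transitivity (\prod_k \prod_j y (lift i j) (lift i k)).
    apply: eq_bigr => k _; apply: eq_bigr => j _.
    by rewrite /y (inj_eq (@lift_inj _ i)).
  rewrite (prod_lift i (fun k => \prod_j y (lift i j) k)) big_mkcond.
  apply: eq_bigr => k _; rewrite (prod_lift i (y^~ k)) -big_mkcond/=.
  by case: ifP => //= ki; rewrite big_pred0.
rewrite tsuji_prod_sqr -prodrXl exchange_big; apply: eq_bigr => k _.
rewrite -prodrXl exchange_big; apply: eq_bigr => j _ /=.
rewrite -big_mkcond prodr_const -/(y j k).
have [jk|jk] := eqVneq j k; first by rewrite /y jk eqxx !expr1n.
congr (_ ^+ _); rewrite (eq_card (_ : _ =i predC (pred2 k j))).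
  have := cardC (pred2 k j); rewrite card2 eq_sym jk card_ord /= => e.
  by move: e; rewrite add2n => -[] /(congr1 predn).
move=> i; by rewrite !inE negb_or unfold_in ![_ == i]eq_sym.
Qed.

End Tsuji.

(** * Normalized Tsuji products and their limit *)

Section TsujiConstant.
Context {R : realType} (D : set R[i]).
Hypotheses (D_neq0 : D !=set0) (D_disc : D `<=` @disc R).

Definition tsuji_sup q : R :=
  sup [set tsuji_prod z | z in [set z : 'I_q -> R[i] | forall k, D (z k)]].

Lemma tsuji_prod_le_sup q (z : 'I_q -> R[i]) : (forall k, D (z k)) ->
  tsuji_prod z <= tsuji_sup q.
Proof.
move=> Dz; apply: ub_le_sup; last by exists z.
exists 1 => _ [w Dw <-]; apply: tsuji_prod_le1 => k; exact/D_disc/Dw.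
Qed.

Lemma tsuji_sup_le q B :
  (forall z : 'I_q -> R[i], (forall k, D (z k)) -> tsuji_prod z <= B) ->
  tsuji_sup q <= B.
Proof.
move=> zB; apply: ge_sup => [|_ [z Dz <-]]; last exact: zB.
by have [a Da] := D_neq0; exists (tsuji_prod (fun _ : 'I_q => a)); exists (fun=> a).
Qed.

Lemma tsuji_sup_ge0 q : 0 <= tsuji_sup q.
Proof.
have [a Da] := D_neq0.
exact: le_trans (tsuji_prod_ge0 _) (@tsuji_prod_le_sup q (fun=> a) (fun=> Da)).
Qed.

(** Deleting each of the [q + 1] points in turn gives [q + 1] configurations of [q] points, each
    bounded by [tsuji_sup q], and [prod_tsuji_prod_lift] evaluates the product of their squares. *)
Lemma tsuji_sup_step q : (1 < q)%N ->
  tsuji_sup q.+1 ^+ q.-1 <= tsuji_sup q ^+ q.+1.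
Proof.
move=> q1; have q0 : (0 < q.-1)%N by rewrite -ltnS prednK// ltnW.
set B := tsuji_sup q ^+ q.+1; have B0 : 0 <= B by rewrite exprn_ge0 ?tsuji_sup_ge0.
(* A supremum is bounded through its elements, so the power on the left is first removed by taking a
   root of [B]. *)
have rootB : (B `^ (q.-1%:R^-1)) ^+ q.-1 = B.
  rewrite -powR_mulrn ?powR_ge0// -powRrM mulVf ?powRr1// pnatr_eq0.
  by rewrite -lt0n.
rewrite -[leRHS]rootB ler_pXn2r ?nnegrE ?powR_ge0 ?tsuji_sup_ge0//.
apply: tsuji_sup_le => z Dz.
rewrite -(@ler_pXn2r _ q.-1) ?nnegrE ?powR_ge0 ?tsuji_prod_ge0// rootB.
rewrite -(@ler_pXn2r _ 2) ?nnegrE ?exprn_ge0 ?tsuji_prod_ge0//.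
rewrite [leLHS]exprAC -prod_tsuji_prod_lift [leRHS]exprAC.
rewrite -[in leRHS](card_ord q.+1) -prodr_const; apply: ler_prod => i _.
rewrite exprn_ge0 ?tsuji_prod_ge0//= ler_pXn2r ?nnegrE ?tsuji_prod_ge0
  ?tsuji_sup_ge0//.
  by apply: tsuji_prod_le_sup => k; exact: Dz.
exact: tsuji_sup_ge0.
Qed.

(** For an extremal configuration, the geometric mean of the hyperbolic distances over the
    [q (q - 1)] ordered pairs. *)
Definition tsuji_radius q : R := (tsuji_sup q ^+ 2) `^ (q * q.-1)%:R^-1.

Lemma tsuji_radius_ge0 q : 0 <= tsuji_radius q.
Proof. exact: powR_ge0. Qed.

Lemma tsuji_radiusX q : (1 < q)%N ->
  tsuji_radius q ^+ (q * q.-1) = tsuji_sup q ^+ 2.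
Proof.
move=> q1; rewrite -powR_mulrn ?powR_ge0// -powRrM mulVf ?powRr1 ?sqr_ge0//.
by rewrite pnatr_eq0; case: q q1 => [|[]].
Qed.

Lemma tsuji_radius_dec q : (1 < q)%N -> tsuji_radius q.+1 <= tsuji_radius q.
Proof.
move=> q1; have q0 : (0 < q.-1)%N by rewrite -ltnS prednK// ltnW.
rewrite -(@ler_pXn2r _ (q.+1 * q * q.-1)) ?nnegrE ?tsuji_radius_ge0//; last first.
  by rewrite !muln_gt0 q0 (ltnW q1).
have -> : tsuji_radius q.+1 ^+ (q.+1 * q * q.-1) = (tsuji_sup q.+1 ^+ q.-1) ^+ 2.
  by rewrite exprM [_ ^+ (_ * q)](tsuji_radiusX (leqW q1)) exprAC.
have -> : tsuji_radius q ^+ (q.+1 * q * q.-1) = (tsuji_sup q ^+ q.+1) ^+ 2.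
  by rewrite -mulnA mulnC exprM tsuji_radiusX// exprAC.
by rewrite ler_pXn2r ?nnegrE ?exprn_ge0 ?tsuji_sup_step//; exact: tsuji_sup_ge0.
Qed.

(** The hyperbolic transfinite diameter. Indices start at 2, because the exponent of [tsuji_radius]
    degenerates to 0 below. *)
Definition tsuji_constant : R := inf (range (fun n => tsuji_radius n.+2)).

Lemma tsuji_constant_le q : (1 < q)%N -> tsuji_constant <= tsuji_radius q.
Proof.
case: q => [|[|q]]// _; apply: ge_inf; last by exists q.
by exists 0 => _ [n _ <-]; exact: tsuji_radius_ge0.
Qed.

Lemma tsuji_constant_ge0 : 0 <= tsuji_constant.
Proof.
apply: lb_le_inf; first by exists (tsuji_radius 2); exists 0%N.
by move=> _ [n _ <-]; exact: tsuji_radius_ge0.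
Qed.

Lemma cvg_tsuji_radius : tsuji_radius @ \oo --> tsuji_constant.
Proof.
rewrite -(cvg_shiftn 2)/=.
rewrite (_ : (fun n => _) = fun n => tsuji_radius n.+2); last first.
  by apply/funext => n; rewrite addn2.
apply: nonincreasing_cvgn.
  by apply/nonincreasing_seqP => n; exact: tsuji_radius_dec.
by exists 0 => _ [n _ <-]; exact: tsuji_radius_ge0.
Qed.

(* Extremality of [eta] compares the polynomial with the ratio of consecutive
   Tsuji products; [c] allows for [eta] that are only almost extremal. *)
Lemma tsuji_prod_hdist_le q (eta : 'I_q -> R[i]) c w : (1 < q)%N ->
  (forall k, D (eta k)) -> D w -> 0 < c -> 0 < tsuji_prod eta ->
  tsuji_sup q <= c * tsuji_prod eta ->
  \prod_(k < q) hdist w (eta k) <= c * tsuji_radius q ^+ q.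
Proof.
move=> q1 Deta Dw c0 eta0 etac.
have q0 : (0 < q.-1)%N by rewrite -ltnS prednK// ltnW.
set P := \prod_(k < q) _.
have P0 : 0 <= P by apply: prodr_ge0 => k _; exact: hdist_ge0.
have V0 : 0 < tsuji_sup q by rewrite (lt_le_trans eta0)// tsuji_prod_le_sup.
(* Appending [w] to [eta] gives a competitor with [q + 1] points. *)
have PV : P / c * tsuji_sup q <= tsuji_sup q.+1.
  apply: (@le_trans _ _ (tsuji_prod (extend eta w))); last first.
    apply: tsuji_prod_le_sup => k; rewrite /extend; case: unliftP => [j _|_] //.
  rewrite tsuji_prod_extend -/P [leRHS]mulrC -mulrA ler_wpM2l//.
  by rewrite ler_pdivrMl.
rewrite mulrC -ler_pdivrMr//.
(* With [V = tsuji_sup q], raising to the power [q - 1] and multiplying by [V^(q - 1)] turns the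
   goal into [(P / c * V)^(q - 1) <= V^(q + 1)], which follows from [PV] and [tsuji_sup_step]. *)
rewrite -(@ler_pXn2r _ q.-1) ?nnegrE ?exprn_ge0 ?tsuji_radius_ge0//; last first.
  by rewrite divr_ge0// ltW.
rewrite -exprM tsuji_radiusX// -(@ler_pM2r _ (tsuji_sup q ^+ q.-1)) ?exprn_gt0//.
rewrite -exprMn -exprD; apply: (@le_trans _ _ (tsuji_sup q.+1 ^+ q.-1)).
  by rewrite ler_pXn2r// nnegrE ?tsuji_sup_ge0// mulr_ge0 ?tsuji_sup_ge0//
    divr_ge0// ltW.
by rewrite addSn add1n prednK ?tsuji_sup_step// ltnW.
Qed.

End TsujiConstant.

(** * Lower bound for the maximum of a Blaschke product over the region *)

(** If [x ^+ Q] exceeded [y], the powers of [x ^+ Q / y] would outgrow the factor [(Q * s)%:R * K],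
    which is linear in [s]. *)
Lemma le_of_subexp_growth (R : realType) (K x y : R) (Q : nat) :
  (0 < Q)%N -> 0 <= K -> 0 <= x -> 0 <= y ->
  (forall s, (1 < s)%N -> x ^+ (Q * s).-1 <= (Q * s)%:R * K * y ^+ s.-1) ->
  x ^+ Q <= y.
Proof.
move=> Q0 K0 x0 y0 xy; rewrite leNgt; apply/negP => yx.
have x_gt0 : 0 < x.
  rewrite lt_neqAle x0 andbT eq_sym; apply: contraTneq yx => ->.
  by rewrite expr0n gtn_eqF// -leNgt.
have y_gt0 : 0 < y.
  rewrite lt_neqAle y0 andbT eq_sym; apply/eqP => y_eq0.
  have := xy 2 isT; rewrite y_eq0 expr0n/= mulr0 => /(lt_le_trans (exprn_gt0 _
    x_gt0)).
  by rewrite ltxx.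
pose d := x ^+ Q / y - 1.
have d0 : 0 < d by rewrite subr_gt0 ltr_pdivlMr// mul1r.
pose c := x ^+ Q.-1.
have c0 : 0 < c by rewrite exprn_gt0.
(* Taking [s = 2 k + 1] makes the power of [x ^+ Q / y = 1 + d] a square, so the inequality
   [k d <= (1 + d)^k] already gives quadratic growth against a linear right-hand side. *)
have bound k : (0 < k)%N -> c * (k%:R * d) ^+ 2 <= Q%:R * (2 * k%:R + 1) * K.
  move=> k0.
  have := xy (k * 2).+1; rewrite ltnS muln_gt0 k0 => /(_ isT).
  have -> : (Q * (k * 2).+1).-1 = (Q * (k * 2) + Q.-1)%N.
    by rewrite mulnS addnC; case: (Q) Q0 => // Q' _; rewrite addnS.
  rewrite exprD exprM -/c -ler_pdivrMr ?exprn_gt0// mulrAC -expr_div_n => h.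
  rewrite natrM -natr1 natrM [k%:R * 2]mulrC in h.
  apply: le_trans h; rewrite mulrC ler_wpM2r ?(ltW c0)// exprM.
  rewrite ler_pXn2r ?nnegrE ?exprn_ge0 ?mulr_ge0 ?divr_ge0 ?exprn_ge0 ?invr_ge0
    ?(ltW d0)//.
  have -> : x ^+ Q / y = 1 + d by rewrite /d addrC subrK.
  elim: (k) => [|n IHn]; first by rewrite mul0r.
  rewrite exprSr -natr1; apply: (@le_trans _ _ ((1 + d) ^+ n + d)).
    by rewrite mulrDl mul1r lerD2r.
  rewrite mulrDr mulr1 lerD2l ler_peMl ?(ltW d0)//.
  by rewrite exprn_ege1// lerDl ltW.
pose N := Num.bound (Q%:R * 3 * K / (c * d ^+ 2)).
have X0 : 0 <= Q%:R * 3 * K / (c * d ^+ 2).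
  by rewrite divr_ge0// !mulr_ge0// ?exprn_ge0// ltW.
have := archi_boundP X0; rewrite -/N ltr_pdivrMr ?mulr_gt0 ?exprn_gt0// => hN.
have N0 : (0 < N)%N.
  by rewrite -(ltr0n R); apply: le_lt_trans X0 (archi_boundP X0).
have N1 : 1 <= N%:R :> R by rewrite ler1n.
have := bound _ N0; apply/negP; rewrite -ltNge.
apply: (@le_lt_trans _ _ (Q%:R * 3 * K * N%:R)).
  have -> : Q%:R * (2 * N%:R + 1) * K = Q%:R * K * (2 * N%:R + 1) by ring.
  have -> : Q%:R * 3 * K * N%:R = Q%:R * K * (3 * N%:R) by ring.
  rewrite ler_wpM2l ?mulr_ge0//; lra.
have -> : c * (N%:R * d) ^+ 2 = N%:R * (c * d ^+ 2) * N%:R by ring.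
by rewrite ltr_pM2r// (lt_le_trans ltr01 N1).
Qed.

(** Each full period contributes at most [M], and the remaining factors are at most 1. *)
Lemma prod_period_le (R : realFieldType) (F : nat -> R) (Q : nat) (M : R) n :
  (0 < Q)%N -> (forall j, 0 <= F j <= 1) -> (forall j, F (j + Q)%N = F j) ->
  \prod_(j < Q) F j <= M -> \prod_(j < n) F j <= M ^+ (n %/ Q).
Proof.
move=> Q0 F01 FQ FM.
have P0 a b : 0 <= \prod_(a <= j < b) F j.
  by apply: prodr_ge0 => j _; have /andP[] := F01 j.
have step a : \prod_(0 <= j < a * Q) F j <= M ^+ a.
  elim: a => [|a IHa]; first by rewrite mul0n big_geq.
  rewrite mulSn addnC (big_cat_nat _ (leq_addr Q (a * Q)))//= exprSr.
  rewrite ler_pM//; rewrite -{1}[(a * Q)%N]add0n big_addn addKn big_mkord.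
  apply: le_trans FM; apply: ler_prod => j _;
    have /andP[-> _] /= := F01 (j + a * Q)%N.
  rewrite [leLHS](_ : _ = F j)//; elim: a {IHa} => [|a IHa];
    first by rewrite mul0n addn0.
  by rewrite mulSn addnCA addnC FQ.
rewrite -(big_mkord xpredT) {1}(divn_eq n Q).
rewrite (big_cat_nat _ (leq_addr (n %% Q) (n %/ Q * Q)))//=.
apply: le_trans (step _); rewrite ler_piMr// big_seq.
by apply: prodr_ile1.
Qed.

(** Each quotient below [s] occurs [Q] times, so the exponents add up to
    [2 Q (0 + ... + (s - 1)) = Q s (s - 1)]. *)
Lemma prod_floor_exp (R : comPzRingType) (M : R) (Q s : nat) : (0 < Q)%N ->
  \prod_(k < Q * s) (M ^+ (k %/ Q)) ^+ 2 = (M ^+ s.-1) ^+ (Q * s).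
Proof.
move=> Q0; elim: s => [|s IHs]; first by rewrite muln0 big_ord0 expr0.
rewrite -(big_mkord xpredT (fun k => (M ^+ (k %/ Q)) ^+ 2)) mulnS addnC.
rewrite (big_cat_nat _ (leq_addr Q (Q * s)))//= big_mkord IHs.
have -> : \prod_(Q * s <= k < Q * s + Q) (M ^+ (k %/ Q)) ^+ 2 =
    \prod_(k < Q) (M ^+ ((k + Q * s) %/ Q)) ^+ 2.
  by rewrite -{1}[(Q * s)%N]add0n big_addn addKn big_mkord.
under eq_bigr => k _.
  rewrite divnDr ?dvdn_mulr// divn_small ?ltn_ord// mulKn// add0n.
  over.
rewrite prodr_const card_ord -!exprM -exprD; congr (_ ^+ _).
case: s {IHs} => [|s]; rewrite /= ?muln0//.
rewrite mul2n -addnn !mulnDr [X in _ = (X + _)%N]mulSn [(Q * s.+1)%N]mulnC.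
by rewrite addnA; congr addn; rewrite addnC.
Qed.

Section Capacity.
Context {R : realType} (D : set R[i]).
Hypotheses (D_neq0 : D !=set0) (D_disc : D `<=` @disc R).

Lemma norm_blaschke_prod (mu : nat -> R[i]) n z :
  `|blaschke_prod mu n z| = (\prod_(j < n) hdist z (mu j))%:C%C.
Proof.
by rewrite normr_prod rmorph_prod; apply: eq_bigr => j _; rewrite normrE.
Qed.

(** [tsuji_prod_le_width] is applied to the periodic repetition of [mu], whose first [k] factors
    contain [k %/ Q] full copies of the given Blaschke product. *)
Lemma tsuji_sup_sqr_le (r : R) Q s (mu : 'I_Q -> R[i]) M :
  0 <= r < 1 -> (forall z, D z -> cabs z <= r) -> (0 < Q)%N ->
  (forall k, disc (mu k)) ->
  (forall z, D z -> \prod_(k < Q) hdist z (mu k) <= M) ->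
  tsuji_sup D (Q * s) ^+ 2 <=
  ((Q * s)%:R * (1 - r ^+ 2)^-1 * M ^+ s.-1) ^+ (Q * s).
Proof.
move=> r01 Dr Q0 mu1 muM; have [a Da] := D_neq0.
have M0 : 0 <= M.
  by apply: le_trans (muM _ Da); apply: prodr_ge0 => k _; exact: hdist_ge0.
set B := _ ^+ (Q * s); have B0 : 0 <= B.
  rewrite exprn_ge0// !mulr_ge0 ?exprn_ge0// invr_ge0 subr_ge0.
  by have /andP[r0 r1] := r01; rewrite exprn_ile1// ltW.
have sqB : (Num.sqrt B) ^+ 2 = B by rewrite sqr_sqrtr.
rewrite -sqB ler_pXn2r ?nnegrE ?sqrtr_ge0 ?tsuji_sup_ge0//.
apply: tsuji_sup_le => // z Dz.
rewrite -(@ler_pXn2r _ 2) ?nnegrE ?sqrtr_ge0 ?tsuji_prod_ge0// sqB.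
(* The points of the configuration are continued by [a], which lies in [D], so that bounds valid on
   [D] hold at every index. *)
pose zz k := oapp z a (insub k).
have zzE (k : 'I_(Q * s)) : zz k = z k by rewrite /zz valK.
have Dzz k : D (zz k) by rewrite /zz; case: insubP => /=.
pose nu k := mu (Ordinal (ltn_pmod k Q0)).
have nu1 k : disc (nu k) by exact: mu1.
have r01C : 0 <= (r%:C%C : R[i]) < 1.
  by rewrite ler0c -(rmorph1 (real_complex R)) ltcR.
have zzr i : `|zz i| <= r%:C%C by rewrite normrE lecR Dr.
have nu1' i : `|nu i| < 1 by exact: disc_norm.
have bM k i : `|blaschke_prod nu k (zz i)| <= (M ^+ (k %/ Q))%:C%C.
  rewrite norm_blaschke_prod lecR.
  apply: (@prod_period_le _ (fun j => hdist (zz i) (nu j))) => // [j|j|].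
  - by rewrite hdist_ge0 hdist_le1//; exact: D_disc.
  - by congr (hdist _ (mu _)); apply/val_inj; rewrite /= modnDr.
  apply: le_trans (muM _ (Dzz i)); apply: ler_prod => k0 _.
  rewrite hdist_ge0/= [leLHS](_ : _ = hdist (zz i) (mu k0))//.
  by congr (hdist _ (mu _)); apply/val_inj; rewrite /= modn_small.
have := tsuji_prod_le_width (Q * s) r01C zzr nu1' bM.
have -> : \prod_(k < Q * s) ((Q * s)%:R / (1 - (r%:C%C : R[i]) ^+ 2) *
    (M ^+ (k %/ Q))%:C%C ^+ 2) = B%:C%C.
  rewrite big_split/= prodr_const card_ord /B [in RHS]exprMn.
  rewrite -prod_floor_exp// [RHS]rmorphM; congr (_ * _).
    rewrite [RHS]rmorphXn; congr (_ ^+ _).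
    by rewrite [RHS]rmorphM [X in _ = _ * X]fmorphV rmorphB rmorph1 rmorphXn
      rmorph_nat.
  by rewrite [RHS]rmorph_prod; apply: eq_bigr => k _; rewrite [RHS]rmorphXn.
rewrite (_ : \prod_(i < _) _ = (tsuji_prod z ^+ 2)%:C%C) ?lecR//.
rewrite rmorphXn prodrXl; congr (_ ^+ 2).
rewrite rmorph_prod; apply: eq_bigr => k _; rewrite norm_blaschke_prod.
congr (_%:C%C); rewrite (big_ord_widen (Q * s) (fun j => hdist (zz k) (zz j))).
  by apply: eq_bigr => j _; rewrite !zzE hdistC.
exact/ltnW/ltn_ord.
Qed.

(** With [n = Q s] and [d] the Tsuji constant, [d^(n (n - 1))] is at most the squared Tsuji
    supremum, hence at most [(n K M^(s - 1))^n]. An [n]-th root leaves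
    [d^(Q s - 1) <= Q s K M^(s - 1)] for every [s > 1], and [le_of_subexp_growth] concludes. *)
Lemma tsuji_constantX_le (r : R) Q (mu : 'I_Q -> R[i]) M :
  0 <= r < 1 -> (forall z, D z -> cabs z <= r) -> (0 < Q)%N ->
  (forall k, disc (mu k)) ->
  (forall z, D z -> \prod_(k < Q) hdist z (mu k) <= M) ->
  tsuji_constant D ^+ Q <= M.
Proof.
move=> r01 Dr Q0 mu1 muM; have [a Da] := D_neq0.
have M0 : 0 <= M.
  by apply: le_trans (muM _ Da); apply: prodr_ge0 => k _; exact: hdist_ge0.
have K0 : 0 <= (1 - r ^+ 2)^-1.
  by have /andP[r0 r1] := r01; rewrite invr_ge0 subr_ge0 exprn_ile1// ltW.
apply: (le_of_subexp_growth Q0 K0) => //; first exact: tsuji_constant_ge0.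
move=> s s1; have n1 : (1 < Q * s)%N by apply: leq_trans s1 _; rewrite leq_pmull.
have n0 : (0 < Q * s)%N by apply: ltnW.
rewrite -(@ler_pXn2r _ (Q * s)) ?nnegrE ?exprn_ge0 ?tsuji_constant_ge0//; last first.
  by rewrite !mulr_ge0 ?exprn_ge0.
apply: le_trans (tsuji_sup_sqr_le s r01 Dr Q0 mu1 muM).
rewrite -tsuji_radiusX// -exprM mulnC.
by rewrite lerXn2r ?nnegrE ?tsuji_constant_ge0 ?tsuji_radius_ge0 ?tsuji_constant_le.
Qed.
End Capacity.

(** * Topological preliminaries *)

Lemma cvg_root1 (R : realType) (a : R) : 0 < a ->
  (fun q : nat => a `^ (q%:R^-1)) @ \oo --> (1 : R).
Proof.
move=> a0; have inv0 : (fun q : nat => q%:R^-1 : R) @ \oo --> (0 : R).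
  by rewrite -cvg_shiftS; exact: cvg_harmonic.
rewrite (_ : (fun q : nat => _) = fun q : nat => expR (q%:R^-1 * ln a)).
  have : (fun q : nat => q%:R^-1 * ln a) @ \oo --> 0 * ln a.
    exact: (cvgM inv0 (cvg_cst (ln a))).
  rewrite mul0r => h; rewrite -[X in _ --> X]expR0.
  by apply: continuous_cvg h; exact: continuous_expR.
by apply/funext => q; rewrite /powR gt_eqF.
Qed.

Lemma limn_einf_ge (R : realType) (u v : nat -> R) (l : R) :
  u @ \oo --> l -> (forall n, u n <= v n) ->
  (l%:E <= limn_einf (fun n => (v n)%:E))%E.
Proof.
move=> ul uv; have /cvg_limn_einf_sup[<- _] : (fun n => (u n)%:E) @ \oo --> l%:E.
  by apply/fine_cvgP; split; first exact: nearW.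
rewrite !limn_einf_lim; apply: lee_lim; [exact: is_cvg_einfs..|].
apply: nearW => n; apply: le_ereal_inf_tmp => _ [k /= nk <-].
apply: (@le_trans _ _ (u k)%:E); last by rewrite lee_fin.
by apply: ereal_inf_lbound; exists k.
Qed.

Section Compactness.
Context {R : realType}.
Implicit Types (D : set R[i]).

Lemma cabs_dist_le (x y : R[i]) : `|cabs x - cabs y| <= cabs (x - y).
Proof.
have cabsD (u v : R[i]) : cabs (u + v) <= cabs u + cabs v.
  by rewrite -lecR rmorphD/= -!normrE ler_normD.
rewrite ler_norml; apply/andP; split; last first.
  by rewrite lerBlDr (le_trans _ (cabsD _ _))// subrK.
have -> : cabs (x - y) = cabs (y - x) by apply: complexI; rewrite -!normrE distrC.
by rewrite lerNl opprB lerBlDr (le_trans _ (cabsD _ _))// subrK.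
Qed.

Lemma cabs_affine_continuous (a b : R[i]) :
  continuous (fun z : R[i]^o => cabs (a + b * z) : R).
Proof.
move=> z; apply/(cvgrPdist_lt (FF := @nbhs_filter R[i]^o z)) => e e0.
have b0 : 0 < cabs b + 1 by rewrite ltr_wpDl// cabs_ge0.
apply/nbhs_ballP; exists (e / (cabs b + 1))%:C%C;
  first by rewrite /= (ltcR 0) divr_gt0.
move=> y; rewrite -ball_normE /= => zy.
have {}zy : cabs (z - y) < e / (cabs b + 1) by rewrite -ltcR -normrE.
apply: le_lt_trans (cabs_dist_le _ _) _.
rewrite [a + b * z]addrC addrKA -mulrBr cabsM.
apply: (@le_lt_trans _ _ ((cabs b + 1) * cabs (z - y))).
  by rewrite ler_wpM2r ?cabs_ge0// lerDl.
by rewrite mulrC -ltr_pdivlMr.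
Qed.

(** [pole_error] is built from moduli of affine functions of [z], so convergence of these real
    quantities suffices. *)
Lemma cvg_pole_error (F : set_system R[i]) {FF : Filter F} mu q (z : R[i]) :
  (forall k, disc (mu k)) -> disc z ->
  (forall a b, cabs (a + b * x) @[x --> F] --> (cabs (a + b * z) : R)) ->
  pole_error mu q x @[x --> F] --> pole_error mu q z.
Proof.
move=> mu1 z1 Fz; apply: cvgM; last first.
  apply: cvgV.
    by rewrite gt_eqF// sqrtr_gt0 subr_gt0 expr_lt1// cabs_ge0.
  apply: continuous_cvg; first exact: sqrt_continuous.
  apply: cvgB; first exact: cvg_cst.
  have cz : cabs x @[x --> F] --> cabs z.
    by have := Fz 0 1; under eq_fun do rewrite add0r mul1r; rewrite add0r mul1r.
  by rewrite expr2; under eq_fun do rewrite expr2; apply: cvgM.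
elim: q => [|q IHq].
  by rewrite /reduced_prod big_ord0; under eq_fun do rewrite big_ord0; exact: cvg_cst.
rewrite reduced_prodS cabsM; under eq_fun do rewrite reduced_prodS cabsM.
apply: cvgM => //; case: ifP => _; last exact: cvg_cst.
have E x : cabs (blaschke (mu q) x) =
    cabs (- mu q + 1 * x) / cabs (1 + (- (mu q)^*) * x).
  by rewrite /blaschke cabsM cabsV mul1r addrC mulNr.
rewrite E; under eq_fun do rewrite E.
apply: cvgM; first exact: Fz.
apply: cvgV; last exact: Fz.
have : 0 < cabs (1 - (mu q)^* * z).
  by rewrite -ltcR -normrE normr_gt0 disc_den_neq0//; exact: disc_norm.
by rewrite -mulNr => /gt_eqF ->.
Qed.

Lemma cabs_continuous : continuous (fun z : R[i]^o => cabs z : R).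
Proof.
rewrite (_ : (fun z : R[i]^o => _) = fun z : R[i]^o => cabs (0 + 1 * z)); last first.
  by apply/funext => z; rewrite add0r mul1r.
exact: cabs_affine_continuous.
Qed.

Lemma compact_attains_max D (f : R[i] -> R) : D !=set0 ->
  compact (D : set R[i]^o) ->
  (forall z, D z -> {for (z : R[i]^o), continuous (f : R[i]^o -> R)}) ->
  exists2 z, D z & forall w, D w -> f w <= f z.
Proof.
move=> D0 Dc fc.
have /(@compact_EVT_max R[i]^o R f D D0 Dc)[z zD zmax] :
    {within (D : set R[i]^o), continuous (f : R[i]^o -> R)}.
  by apply: continuous_in_subspaceT => z /set_mem; exact: fc.
exists z; first exact: set_mem zD.
by move=> w Dw; apply: zmax; exact: mem_set.
Qed.

Lemma compact_disc_radius D : D !=set0 -> compact (D : set R[i]^o) ->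
  D `<=` @disc R -> exists2 r, 0 <= r < 1 & forall z, D z -> cabs z <= r.
Proof.
move=> D0 Dc D1; have [z Dz zmax] := compact_attains_max D0 Dc
  (fun z _ => @cabs_continuous z).
by exists (cabs z) => //; rewrite cabs_ge0 D1.
Qed.

(** If [D] contains [b] besides [a], connectedness makes the distance to [a] take on [D] every value
    between 0 and its value at [b]. Points realizing [q] equally spaced values are distinct. *)
Lemma connected_singleton_or_tsuji_gt0 D : D !=set0 -> connected (D : set R[i]^o) ->
  D `<=` @disc R -> (exists a, D = [set a]) \/ forall q, 0 < tsuji_sup D q.
Proof.
move=> [a Da] Dc D1.
have [aD|/existsNP[b /not_implyP[Db ba]]] := pselect (forall b, D b -> b = a).
  by left; exists a; apply/seteqP; split => [b /aD //|_ ->].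
right => q; pose f (z : R[i]^o) : R := cabs (- a + 1 * z).
have /connected_intervalP fD : connected (f @` (D : set R[i]^o)).
  apply: connected_continuous_connected Dc _.
  by apply: continuous_subspaceT; exact: cabs_affine_continuous.
have f0 : f a = 0 by rewrite /f mul1r addNr cabs0.
have fb : 0 < f b.
  rewrite /f mul1r addrC -ltcR -normrE normr_gt0 subr_eq0; exact/eqP.
have zk (k : 'I_q) : exists z, D z /\ f z = k%:R / q%:R * f b.
  have q0 : (0 < q)%N by apply: leq_ltn_trans (ltn_ord k).
  have [|z Dz fz] := fD _ _ (imageP f Da) (imageP f Db) (k%:R / q%:R * f b).
    rewrite f0 mulr_ge0 ?divr_ge0 ?(ltW fb)//= ler_piMl ?(ltW fb)//.
    by rewrite ler_pdivrMr ?ltr0n// mul1r ler_nat ltnW.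
  by exists z.
have [z zP] := choice zk.
apply: (@lt_le_trans _ _ (tsuji_prod z)); last first.
  by apply: tsuji_prod_le_sup => // k; have [] := zP k.
apply: tsuji_prod_gt0 => [k|j k zjk]; first by apply: D1; have [] := zP k.
have [_ fj] := zP j; have [_ fk] := zP k.
have q0 : (0 < q)%N by apply: leq_ltn_trans (ltn_ord k).
have : j%:R / q%:R * f b = k%:R / q%:R * f b by rewrite -fj -fk zjk.
move=> /(mulIf (lt0r_neq0 fb))/(mulIf _) => /(_ _)/eqP.
rewrite eqr_nat => e; apply/val_inj/eqP; apply: e.
by rewrite invr_eq0 pnatr_eq0 -lt0n.
Qed.

End Compactness.

(** * The hyperbolic Chebyshev constant *)

Lemma powR_rootK (R : realType) q (x : R) : (0 < q)%N -> 0 <= x ->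
  (x `^ q%:R^-1) ^+ q = x.
Proof.
move=> q0 x0; rewrite -powR_mulrn ?powR_ge0// -powRrM mulVf ?powRr1//.
by rewrite pnatr_eq0 -lt0n.
Qed.

Lemma powR_exprK (R : realType) q (x : R) : (0 < q)%N -> 0 <= x ->
  (x ^+ q) `^ q%:R^-1 = x.
Proof.
move=> q0 x0; rewrite -powR_mulrn// -powRrM mulfV ?powRr1//.
by rewrite pnatr_eq0 -lt0n.
Qed.

Section HyperbolicChebyshev.
Context {R : realType} (D : set R[i]).
Hypotheses (D_neq0 : D !=set0) (D_compact : compact (D : set R[i]^o)).
Hypotheses (D_connected : connected (D : set R[i]^o)) (D_disc : D `<=` @disc R).

(** A configuration with at least half of the supremal product suffices, since the factor 2
    disappears under the [q]-th root. For a singleton the product on the left is zero. *)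
Lemma almost_tsuji_points q : (1 < q)%N -> exists2 eta : 'I_q -> R[i],
  forall k, D (eta k) & forall w, D w ->
    \prod_(k < q) hdist w (eta k) <= 2 * tsuji_radius D q ^+ q.
Proof.
move=> q1; have q0 : (0 < q)%N by exact: ltnW.
have [[a Da]|V0] := connected_singleton_or_tsuji_gt0 D_neq0 D_connected D_disc.
  exists (fun=> a) => [_|w]; rewrite Da// => ->.
  rewrite (bigD1 (Ordinal q0))//= hdistE blaschkexx cabs0 mul0r.
  by rewrite mulr_ge0// exprn_ge0// tsuji_radius_ge0.
have [||_ [eta Deta <-] Veta] := @sup_gt _
    [set tsuji_prod z | z in [set z : 'I_q -> R[i] | forall k, D (z k)]]
    (tsuji_sup D q / 2).
- by have [a Da] := D_neq0; exists (tsuji_prod (fun _ : 'I_q => a)); exists (fun=> a).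
- by rewrite -/(tsuji_sup D q) ltr_pdivrMr// ltr_pMr ?V0// ltr1n.
exists eta => // w Dw; apply: tsuji_prod_hdist_le => //.
  by apply: lt_trans Veta; rewrite divr_gt0.
by rewrite -ler_pdivrMl// mulrC ltW.
Qed.

(** When the Tsuji supremum is positive, Tsuji points are distinct and the reduced product is the
    full one. In a singleton they all coincide with [w], where the reduced product vanishes. *)
Lemma tsuji_points_reduced_prod_le q (eta : 'I_q -> R[i]) (mu : nat -> R[i]) w :
  (1 < q)%N -> is_tsuji D eta -> (forall k : 'I_q, mu k = eta k) -> D w ->
  cabs (reduced_prod mu q w) <= tsuji_radius D q ^+ q.
Proof.
move=> q1 [Deta etamax] mueta Dw; have q0 : (0 < q)%N by exact: ltnW.
have [[a Da]|V0] := connected_singleton_or_tsuji_gt0 D_neq0 D_connected D_disc.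
  have -> : w = mu 0%N.
    have := Deta (Ordinal q0); rewrite -mueta Da => ->.
    by move: Dw; rewrite Da.
  by rewrite reduced_prod0// cabs0 exprn_ge0// tsuji_radius_ge0.
have VT : tsuji_sup D q <= tsuji_prod eta by apply: tsuji_sup_le.
have T0 : 0 < tsuji_prod eta by exact: lt_le_trans VT.
rewrite reduced_prod_uniq => [|i j]; last first.
  rewrite !inE => iq jq; rewrite (mueta (Ordinal iq)) (mueta (Ordinal jq)).
  by move=> /(tsuji_prod_neq0_inj (lt0r_neq0 T0))/(congr1 val).
have -> : cabs (blaschke_prod mu q w) = \prod_(k < q) hdist w (eta k).
  apply: complexI; rewrite -normrE norm_blaschke_prod; congr _%:C%C.
  by apply: eq_bigr => k _; rewrite mueta.
rewrite -[leRHS]mul1r; apply: tsuji_prod_hdist_le => //.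
by rewrite mul1r.
Qed.

(** A squeeze: [tsuji_constantX_le] bounds every admissible maximum from below, and
    [almost_tsuji_points] bounds the infimum by [2^(1/q)] times the [q]-th Tsuji radius. *)
Lemma hyp_chebyshevE : hyp_chebyshev D = tsuji_constant D.
Proof.
have [r r01 Dr] := compact_disc_radius D_neq0 D_compact D_disc.
have P0 q (mu : 'I_q -> R[i]) z : 0 <= \prod_(k < q) hdist z (mu k).
  by apply: prodr_ge0 => k _; exact: hdist_ge0.
pose S q (mu : 'I_q -> R[i]) :=
  [set (\prod_(k < q) hdist z (mu k)) `^ q%:R^-1 | z in D].
have S1 q (mu : 'I_q -> R[i]) : (forall k, D (mu k)) -> has_ubound (S q mu).
  move=> Dmu; exists 1 => _ [z Dz <-].
  apply: (@le_trans _ _ (1 `^ q%:R^-1)); last by rewrite powR1.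
  apply: ge0_ler_powR => //.
  - by rewrite nnegrE.
  - by rewrite nnegrE.
  by apply: prodr_ile1 => k _; rewrite hdist_ge0 hdist_le1//; exact: D_disc.
have lbS q : (0 < q)%N -> lbound
    [set sup (S q mu) | mu in [set mu : 'I_q -> R[i] | forall k, D (mu k)]]
    (tsuji_constant D).
  move=> q0 _ [mu Dmu <-]; have [a Da] := D_neq0.
  have s0 : 0 <= sup (S q mu).
    apply: le_trans (_ : _ <= (\prod_(k < q) hdist a (mu k)) `^ q%:R^-1) _.
      exact: powR_ge0.
    by apply: ub_le_sup; [exact: S1|exists a].
  rewrite -(@ler_pXn2r _ q) ?nnegrE ?tsuji_constant_ge0//.
  apply: (tsuji_constantX_le D_neq0 D_disc r01 Dr q0 (mu := mu)) => [k|z Dz].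
    exact/D_disc/Dmu.
  rewrite -[leLHS](@powR_rootK _ q)// lerXn2r ?nnegrE ?powR_ge0//.
  by apply: ub_le_sup; [exact: S1|exists z].
apply: cvg_lim => //.
apply: (@squeeze_cvgr _ _ _ _ (fun=> tsuji_constant D)
  (fun q => 2 `^ q%:R^-1 * tsuji_radius D q)).
- exists 2%N => // q /= q1; have q0 : (0 < q)%N by exact: ltnW.
  have [a Da] := D_neq0; apply/andP; split.
    apply: lb_le_inf; last exact: lbS.
    by exists (sup (S q (fun=> a))); exists (fun=> a).
  have [eta Deta etaP] := almost_tsuji_points q1.
  apply: (@le_trans _ _ (sup (S q eta))).
    apply: ge_inf; last by exists eta.
    by exists (tsuji_constant D); exact: lbS.
  apply: ge_sup => [|_ [z Dz <-]].
    by exists ((\prod_(k < q) hdist a (eta k)) `^ q%:R^-1); exists a.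
  have d0 := tsuji_radius_ge0 D q.
  rewrite -[in leRHS](powR_exprK q0 d0) -powRM ?exprn_ge0//.
  apply: ge0_ler_powR; rewrite ?nnegrE ?mulr_ge0 ?exprn_ge0//.
  exact: etaP.
- exact: cvg_cst.
- rewrite -[X in _ --> X]mul1r; apply: cvgM; first exact: cvg_root1.
  exact: cvg_tsuji_radius.
Qed.

Lemma exists_maxmin_error p m (Rbar : R) q (mu : 'I_q -> R[i]) :
  (0 < p)%N -> (0 < m)%N -> 0 < Rbar -> (forall k, disc (mu k)) ->
  exists (nu : nat -> R[i]) z, [/\ (forall k, disc (nu k)), (forall k : 'I_q,
    nu k = mu k), D z,
    forall w, D w -> pole_error nu q w <= pole_error nu q z &
    is_maxmin_error D Rbar p m mu ((Rbar * pole_error nu q z) `^ q%:R^-1)].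
Proof.
(* The finite family is continued by the center of the disc; only its first [q] values enter
   [pole_error nu q]. *)
move=> p0 m0 Rbar0 mu1; pose nu k := oapp mu 0 (insub k).
have nuE (k : 'I_q) : nu k = mu k by rewrite /nu valK.
have nu1 k : disc (nu k).
  have disc0 : disc (0 : R[i]) by rewrite /disc /mkset cabs0 ltr01.
  by rewrite /nu; case: insub => [j|]; [exact: mu1|exact: disc0].
have pe_cont w : D w -> {for (w : R[i]^o),
    continuous (pole_error nu q : R[i]^o -> R)}.
  move=> Dw; apply: (@cvg_pole_error _ _ (@nbhs_filter R[i]^o w)) => //.
    exact: D_disc.
  by move=> a b; exact: cabs_affine_continuous.
have [z Dz zmax] := compact_attains_max D_neq0 D_compact pe_cont.
exists nu, z; split => //.
rewrite (_ : mu = fun k : 'I_q => nu k); last by apply/funext => k; rewrite nuE.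
exact: is_maxmin_errorP.
Qed.

End HyperbolicChebyshev.

Local Close Scope sesquilinear_scope.

Theorem theorem8 (R : realType) (p m : nat) (p_gt0 : (0 < p)%N)
    (m_gt0 : (0 < m)%N) (D : set R[i]) (D_neq0 : D !=set0)
    (D_compact : compact (D : set R[i]^o))
    (D_connected : connected (D : set R[i]^o))
    (D_disc : D `<=` @disc R) (Rbar : R) (Rbar_gt0 : 0 < Rbar) :
  (forall mu : forall q : nat, 'I_q -> R[i],
     (forall q k, disc (mu q k)) ->
     exists2 e : nat -> R,
       forall q, is_maxmin_error D Rbar p m (mu q) (e q) &
       ((hyp_chebyshev D)%:E <= limn_einf (fun q => (e q)%:E))%E) /\
  (forall eta : forall q : nat, 'I_q -> R[i],
     (forall q, is_tsuji D (eta q)) ->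
     exists2 e : nat -> R,
       forall q, is_maxmin_error D Rbar p m (eta q) (e q) &
       e @ \oo --> hyp_chebyshev D).
Proof.
rewrite hyp_chebyshevE//.
have [r r01 Dr] := compact_disc_radius D_neq0 D_compact D_disc.
have /andP[r0 r1] := r01.
have L0 := tsuji_constant_ge0 D.
have pe_ge0 nu q z : 0 <= pole_error nu q z :> R.
  by rewrite mulr_ge0 ?cabs_ge0// invr_ge0 sqrtr_ge0.
have lower q (nu : nat -> R[i]) z : (forall k, disc (nu k)) -> D z ->
    (forall w, D w -> pole_error nu q w <= pole_error nu q z) ->
    Rbar `^ q%:R^-1 * tsuji_constant D <= (Rbar * pole_error nu q z) `^ q%:R^-1.
  move=> nu1 Dz zmax.
  (* For [q = 0] the exponent is 0 and both powers equal 1, so the claim is that the Tsuji constant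
     is at most 1; a Blaschke product with one factor shows it. *)
  have [->|q0] := posnP q.
    rewrite invr0 !powRr0 mul1r -[leLHS]expr1.
    apply: (tsuji_constantX_le D_neq0 D_disc r01 Dr (mu := fun _ : 'I_1 => z)) => //.
      by move=> _; exact: D_disc.
    by move=> w Dw; rewrite big_ord1 hdist_le1//; exact: D_disc.
  rewrite powRM ?(ltW Rbar_gt0)// ler_wpM2l ?powR_ge0//.
  rewrite -[leLHS](powR_exprK q0)//.
  apply: ge0_ler_powR; rewrite ?nnegrE ?exprn_ge0//.
  apply: (tsuji_constantX_le D_neq0 D_disc r01 Dr q0 (mu := fun k : 'I_q => nu
    k)) => // w Dw.
  apply: le_trans (zmax _ Dw).
  have w1 := D_disc _ Dw.
  (* The denominator of [pole_error] is at most 1, so [pole_error] dominates the reduced product and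
     hence the full Blaschke product. *)
  have s1 : 0 < Num.sqrt (1 - cabs w ^+ 2) <= 1.
    rewrite sqrtr_gt0 subr_gt0 expr_lt1 ?cabs_ge0//= w1/= -[leRHS]sqrtr1 ler_wsqrtr//.
    by rewrite gerBl sqr_ge0.
  have /andP[s0 s_le1] := s1.
  rewrite /pole_error ler_pdivlMr//.
  apply: (@le_trans _ _ (\prod_(k < q) hdist w (nu k))).
    by rewrite ler_piMr// prodr_ge0// => k _; exact: hdist_ge0.
  rewrite -lecR -norm_blaschke_prod -normrE.
  by apply: norm_blaschke_prod_le_reduced => [k|]; exact: disc_norm.
split=> [mu mu1|eta etaP].
  have ex q : exists e, is_maxmin_error D Rbar p m (mu q) e /\
      Rbar `^ q%:R^-1 * tsuji_constant D <= e.
    have [nu [z [nu1 _ Dz zmax emax]]] := exists_maxmin_error D_neq0 D_compact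
      D_disc p_gt0 m_gt0 Rbar_gt0 (mu1 q).
    by exists ((Rbar * pole_error nu q z) `^ q%:R^-1); split => //; exact: lower.
  have [e eP] := choice ex.
  exists e; first by move=> q; have [] := eP q.
  apply: (@limn_einf_ge _ (fun q => Rbar `^ q%:R^-1 * tsuji_constant D)).
    rewrite -[X in _ --> X]mul1r; apply: cvgM; first exact: cvg_root1.
    exact: cvg_cst.
  by move=> q; have [] := eP q.
(* A uniform bound on [D] for the factor [1 / sqrt (1 - |z|^2)]; it tends to 1 under the [q]-th
   root, as does [Rbar]. *)
pose c := (Num.sqrt (1 - r ^+ 2))^-1.
have c0 : 0 < c by rewrite invr_gt0 sqrtr_gt0 subr_gt0 exprn_ilt1.
have ex q : exists e, is_maxmin_error D Rbar p m (eta q) e /\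
    (Rbar `^ q%:R^-1 * tsuji_constant D <= e /\
     ((1 < q)%N -> e <= (Rbar * c) `^ q%:R^-1 * tsuji_radius D q)).
  have eta1 k : disc (eta q k) by have [h _] := etaP q; exact/D_disc/h.
  have [nu [z [nu1 nuE Dz zmax emax]]] := exists_maxmin_error D_neq0 D_compact
    D_disc p_gt0 m_gt0 Rbar_gt0 eta1.
  exists ((Rbar * pole_error nu q z) `^ q%:R^-1); split => //; split;
    first exact: lower.
  move=> q1; have d0 := tsuji_radius_ge0 D q.
  rewrite -[tsuji_radius D q](powR_exprK (ltnW q1))// -powRM ?exprn_ge0//;
    last by rewrite mulr_ge0// ltW.
  apply: ge0_ler_powR.
  - by rewrite invr_ge0.
  - by rewrite nnegrE mulr_ge0// ltW.
  - by rewrite nnegrE !mulr_ge0 ?exprn_ge0// ltW.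
  rewrite -mulrA ler_wpM2l ?(ltW Rbar_gt0)// mulrC ler_pM ?cabs_ge0 ?invr_ge0
    ?sqrtr_ge0//.
    exact: tsuji_points_reduced_prod_le nuE Dz.
  have r2 : 0 < 1 - r ^+ 2 by rewrite subr_gt0 exprn_ilt1.
  have z2 : 0 < 1 - cabs z ^+ 2.
    by rewrite subr_gt0 expr_lt1 ?cabs_ge0//; exact: D_disc.
  rewrite lef_pV2 ?posrE ?sqrtr_gt0//.
  by rewrite ler_wsqrtr// lerB// lerXn2r ?nnegrE ?cabs_ge0 ?Dr.
have [e eP] := choice ex.
exists e; first by move=> q; have [] := eP q.
apply: (@squeeze_cvgr _ _ _ _ (fun q => Rbar `^ q%:R^-1 * tsuji_constant D)
  (fun q => (Rbar * c) `^ q%:R^-1 * tsuji_radius D q)).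
- exists 2%N => // q /= q1; have [_ [-> h]] := eP q.
  exact: h.
- rewrite -[X in _ --> X]mul1r; apply: cvgM; first exact: cvg_root1.
  exact: cvg_cst.
- rewrite -[X in _ --> X]mul1r; apply: cvgM; last exact: cvg_tsuji_radius.
  by apply: cvg_root1; exact: mulr_gt0.
Qed.
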